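(* Let initial conditions $(x_1(0),\ldots,x_n(0),y_1(0),\ldots,y_n(0))$ for the Toda system be given with $\sum_k x_k(0)=\sum_k y_k(0)=0$. Apply Flaschka's transformation to obtain the Jacobi matrix $J(0)$, with eigenvalues $\lambda_1<\cdots<\lambda_n$ and bidiagonal coordinates $\beta_k^{\pi_\pm}$, $k=1,\ldots,n-1$, for the permutations $\pi_-(k)=k$ and $\pi_+(k)=n+1-k$. Then the asymptotic constants $c_k^\pm,d_k^\pm$ (defined by $x_k(t)-c_k^\pm t-d_k^\pm\to0$ as $t\to\pm\infty$) are given, for $k=1,\ldots,n$, by $$c_k^\pm=-2\lambda_{\pi_\pm(k)},\qquad d_k^\pm=\sum_{j<k}\frac{-2j}{n}\tilde\beta_j^{\pi_\pm}+\sum_{j\ge k}\frac{2(n-j)}{n}\tilde\beta_j^{\pi_\pm}+(n-2k+1)\log 2,$$ where $\tilde\beta_k^{\pi_\pm}=\log\beta_k^{\pi_\pm}$ (and in the sums $1\le j\le n-1$). The scattering map $S(c_1^-,\ldots,c_n^-,d_1^-,\ldots,d_n^-)=(c_1^+,\ldots,c_n^+,d_1^+,\ldots,d_n^+)$ is given, for $k=1,\ldots,n$, by $$c_{n+1-k}^+=c_k^-,\qquad d_{n+1-k}^+=d_k^-+2\sum_{j<k}\log|c_j^--c_k^-|-2\sum_{j>k}\log|c_j^--c_k^-|$$ (with $1 \le j\le n$ in the sums).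
   Context: Toda system: $n \ge 2$ particles of mass $1$ on the line with positions $x_k(t)$ and velocities $y_k(t)$ evolving under the Hamiltonian $H(x,y)=\sum_{k=1}^n\frac{y_k^2}{2}+\sum_{k=1}^{n-1}\exp(x_k-x_{k+1})$, i.e. $x_k'=y_k$, $y_k'=\exp(x_{k-1}-x_k)-\exp(x_k-x_{k+1})$ for $k=1,\ldots,n$, with the formal conventions $x_0=-\infty$, $x_{n+1}=+\infty$ (so the corresponding exponentials are zero). Flaschka's transformation associates to $(x,y)$ the real symmetric tridiagonal $n\times n$ matrix $J$ with $J_{k,k}=-\frac12y_k$ and $J_{k,k+1}=J_{k+1,k}=\frac12\exp\left(\frac{x_k-x_{k+1}}{2}\right)$. It is a Jacobi matrix (positive off-diagonal entries), hence has simple spectrum $\lambda_1<\cdots<\lambda_n$, which is preserved by the evolution. Bidiagonal coordinates: a matrix $M$ is $LU$-positive if it admits a (unique) factorization $M=LU$ with $L=\mathbf{L}(M)$ lower triangular with unit diagonal and $U$ upper triangular with positive diagonal entries. For $\pi\in S_n$ let $\Lambda^\pi=\operatorname{diag}(\lambda_{\pi(1)},\ldots,\lambda_{\pi(n)})$. A Jacobi matrix $J$ with eigenvalues $\lambda_1<\cdots<\lambda_n$ has a unique diagonalization $J=Q_\pi^*\Lambda^\pi Q_\pi$ with $Q_\pi$ orthogonal and $LU$-positive ($^*$ denotes transpose). With $L_\pi=\mathbf{L}(Q_\pi)$, the matrix $B_\pi=L_\pi^{-1}\Lambda^\pi L_\pi$ is lower bidiagonal and the $\pi$-bidiagonal coordinates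 of $J$ are $\beta_k^\pi=(B_\pi)_{k+1,k}$, $k=1,\ldots,n-1$; they are positive for Jacobi matrices. Asymptotically as $t\to\pm\infty$ the particles undertake independent uniform motions: there are constants $c_k^\pm,d_k^\pm$ with $x_k(t)-c_k^\pm t-d_k^\pm\to0$ as $t\to\pm\infty$. The wave maps are $W^\pm(x_1(0),\ldots,x_n(0),y_1(0),\ldots,y_n(0))=(c_1^\pm,\ldots,c_n^\pm,d_1^\pm,\ldots,d_n^\pm)$, and the scattering map $S$ is defined by $S\circ W^-=W^+$. *)

(* Defs.v *)
From HB Require Import structures.
From mathcomp Require Import all_boot all_order all_algebra all_fingroup.
From mathcomp Require Import all_classical all_reals all_analysis.

Set Implicit Arguments.
Unset Strict Implicit.
Unset Printing Implicit Defensive.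

Import Order.TTheory GRing.Theory Num.Theory.
Import numFieldNormedType.Exports.

Local Open Scope classical_set_scope.
Local Open Scope ring_scope.

Section Matrices.
Variable R : realType.

(* Indices are shifted by one: the particle k of the text (1 <= k <= n) is the
   ordinal k - 1 : 'I_n, and a sub-diagonal position k (1 <= k <= n - 1) is the
   ordinal k - 1 : 'I_n.-1. *)
Lemma ord_next_subproof n (k : 'I_n.-1) : (k.+1 < n)%N.
Proof. by rewrite -ltn_predRL. Qed.

Definition ord_this n (k : 'I_n.-1) : 'I_n := widen_ord (leq_pred n) k.
Definition ord_next n (k : 'I_n.-1) : 'I_n := Ordinal (ord_next_subproof k).

Definition lower_unit n (L : 'M[R]_n) : Prop :=
  is_trig_mx L /\ forall i, L i i = 1.

Definition upper_pos n (U : 'M[R]_n) : Prop :=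
  is_trig_mx U^T /\ forall i, 0 < U i i.

Definition LU_positive n (M : 'M[R]_n) : Prop :=
  exists L U : 'M[R]_n, [/\ lower_unit L, upper_pos U & M = L *m U].

(* The factor L is unique for an LU-positive M; the value 0 is only taken when
   M is not LU-positive. *)
Definition LU_lower n (M : 'M[R]_n) : 'M[R]_n :=
  xget 0 [set L | lower_unit L /\ exists2 U, upper_pos U & M = L *m U].

Definition diag_perm n (lambda : 'I_n -> R) (pi : 'S_n) : 'M[R]_n :=
  diag_mx (\row_k lambda (pi k)).

(* Unique when J is a Jacobi matrix with simple spectrum lambda. *)
Definition LU_diagonalizer n (J : 'M[R]_n) (lambda : 'I_n -> R) (pi : 'S_n) :
    'M[R]_n :=
  xget 0 [set Q | [/\ Q^T *m Q = 1%:M, LU_positive Q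
                    & J = Q^T *m diag_perm lambda pi *m Q]].

Definition bidiagonal_mx n (J : 'M[R]_n) (lambda : 'I_n -> R) (pi : 'S_n) :
    'M[R]_n :=
  let L := LU_lower (LU_diagonalizer J lambda pi) in
  invmx L *m diag_perm lambda pi *m L.

Definition bidiagonal_coord n (J : 'M[R]_n) (lambda : 'I_n -> R) (pi : 'S_n)
    (k : 'I_n.-1) : R :=
  bidiagonal_mx J lambda pi (ord_next k) (ord_this k).

Definition ordered_spectrum n (J : 'M[R]_n) (lambda : 'I_n -> R) : Prop :=
  (forall i j : 'I_n, (i < j)%N -> lambda i < lambda j) /\
  (forall i, eigenvalue J (lambda i)).

Definition perm_minus n : 'S_n := 1%g.
Definition perm_plus n : 'S_n := perm (@rev_ord_inj n).

End Matrices.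

Section Toda.
Variables (R : realType) (n : nat).

Local Notation vec := 'rV[R]_n.

(* exp(x_{k-1} - x_k) - exp(x_k - x_{k+1}); each sum has one term, or none when
   the neighbour is absent, i.e. x_0 = -oo or x_{n+1} = +oo. *)
Definition toda_force (x : vec) (k : 'I_n) : R :=
  \sum_(j < n | j.+1 == k :> nat) expR (x 0 j - x 0 k)
  - \sum_(j < n | k.+1 == j :> nat) expR (x 0 k - x 0 j).

Definition toda_solution (x y : R -> vec) : Prop :=
  forall (t : R) (k : 'I_n),
    is_derive t 1 (fun s => x s 0 k) (y t 0 k) /\
    is_derive t 1 (fun s => y s 0 k) (toda_force (x t) k).

Definition flaschka (x y : vec) : 'M[R]_n :=
  \matrix_(i, j)
    if i == j then - (y 0 i / 2)
    else if i.+1 == j :> nat then expR ((x 0 i - x 0 j) / 2) / 2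
    else if j.+1 == i :> nat then expR ((x 0 j - x 0 i) / 2) / 2
    else 0.

Definition toda_asymptotics (F : set_system R) (x : R -> vec) (cd : vec * vec) :
    Prop :=
  forall k : 'I_n, (x t 0 k - cd.1 0 k * t - cd.2 0 k) @[t --> F] --> (0 : R).

(* The value (0, 0) is only taken when no trajectory from (x0, y0) has
   asymptotic constants along F. *)
Definition wave_map (F : set_system R) (x0y0 : vec * vec) : vec * vec :=
  xget (0, 0) [set cd | exists x y : R -> vec,
    [/\ toda_solution x y, (x 0, y 0) = x0y0 & toda_asymptotics F x cd]].

Definition wave_minus : vec * vec -> vec * vec := wave_map (ninfty_nbhs R).
Definition wave_plus : vec * vec -> vec * vec := wave_map (pinfty_nbhs R).

(* The map S with S \o wave_minus = wave_plus, on the image of wave_minus. *)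
Definition scattering_map (cd : vec * vec) : vec * vec :=
  xget (0, 0) [set cd' | exists2 z, wave_minus z = cd & wave_plus z = cd'].

End Toda.

(* Main.v *)
Require Import Defs.
From HB Require Import structures.
From mathcomp Require Import all_boot all_order all_algebra all_fingroup.
From mathcomp Require Import all_classical all_reals all_analysis.
From mathcomp Require Import ring lra zify.

(** Indices start at 0, as in the statement.  Put [a_k = - y_k / 2],
    [b_k = exp (x_(k-1) - x_k) / 4] (zero at both ends) and let [P_k] be the
    monic polynomials with [P_(k+1) = (X - a_k) P_k - b_k P_(k-1)]: they are
    the characteristic polynomials of the leading principal blocks of the
    Flaschka matrix.  With [E_k = 4^k exp x_k] one has
    [b_(k+1) E_(k+1) = E_k], so that [1 / E_k] is the squared norm of [P_k]
    for the discrete measure that gives the eigenvalue [lambda_i] the mass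
    [1 / g_i], where [g_i = \sum_k E_k P_k(lambda_i)^2].  The particle [x_k] is
    thus, up to sign and the term [k ln 4], the logarithm of the squared norm
    of an orthogonal polynomial.

    Along a Toda trajectory [P_k' = - 2 b_k P_(k-1)] at each fixed argument.
    Hence [P_n] does not move, and a telescoping sum gives
    [g_i' = - 2 lambda_i g_i]: the masses are [exp (2 lambda_i t) / g_i(0)].
    Every trajectory obeys these formulas, which involve its initial data
    alone; trajectories with the same initial data therefore have the same
    asymptotes, and the wave maps are given by the formulas below.

    Order the eigenvalues as [mu_0, mu_1, ...] so that along the limit
    considered each mass is negligible compared with the preceding ones, let
    [g_i] now be the sum at [mu_i], and let [q_k = \prod_(j < k) (X - mu_j)].  Since [q_k] is monic of degree [k]
    and vanishes at the [k] heaviest nodes, the minimality of orthogonal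
    polynomials bounds [1 / E_k] above by
    [\sum_(i >= k) q_k(mu_i)^2 exp (2 mu_i t) / g_i(0)], a sum dominated by its
    term [i = k] ([newton_norm_ge]).  The product over [k] of these dominant
    terms equals the product of the [1 / E_k] exactly, both being the
    determinant of the Gram matrix of a monic basis ([newton_det]).  Upper
    bounds on factors whose product is known are also lower bounds, so each
    [1 / E_k] is equivalent to its dominant term ([cvg0_sum0_bounded],
    [toda_asymptoticsP]).  This yields [c_k = - 2 mu_k] and
    [d_k = - ln (q_k(mu_k)^2 / g_k(0)) - 2 k ln 2].

    For the bidiagonal coordinates, an orthogonal diagonalizer has rows
    [sigma_i 2^k exp (x_k / 2) P_k(mu_i)] with [sigma_i^2 = 1 / g_i].  Expanding
    [P_k] in the Newton basis [q_j] is an LU factorization whose lower factor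
    is built from the values [sigma_i q_j(mu_i)]; positivity of the upper
    factor means that [gamma_k = sigma_k q_k(mu_k) > 0], and the Newton
    recursion gives [beta_k = gamma_(k+1) / gamma_k] ([bidiagonal_coordE]).  As
    [gamma_k^2 = q_k(mu_k)^2 / g_k], the consecutive differences of the phases
    [d_k] are [2 ln beta_k + 2 ln 2], and [\sum_k d_k = \sum_k x_k(0) = 0]
    determines them.

    The two orders of the eigenvalues give two formulas for the phases with the
    same [g_i]; eliminating [g_i] gives the scattering relation.  Conversely
    the image of a point under the past wave map contains its eigenvalues
    ([past_velocity_root]), so this relation holds for all points with
    the same past, and the scattering map is well defined. *)

Set Implicit Arguments.
Unset Strict Implicit.
Unset Printing Implicit Defensive.

Import Order.TTheory GRing.Theory Num.Theory.
Import numFieldNormedType.Exports.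

Local Open Scope classical_set_scope.
Local Open Scope ring_scope.

(** * Monic polynomials of a Jacobi matrix and Newton polynomials *)

Section Graded.
Variables (F : fieldType) (n : nat).
Implicit Types (p q : 'I_n -> {poly F}).

Definition graded p := forall k : 'I_n, p k \is monic /\ size (p k) = k.+1.

(** Subtracting a multiple of [q j] removes the coefficient of degree [j], from
    the top degree down; the vanishing of the
    coefficients of index at least [m] is what makes change-of-basis matrices
    triangular. *)
Lemma graded_span q (m : nat) (f : {poly F}) :
  graded q -> (m <= n)%N -> (size f <= m)%N ->
  exists c : 'I_n -> F,
    (forall j : 'I_n, (m <= j)%N -> c j = 0) /\ f = \sum_j c j *: q j.
Proof.
move=> gq; elim: m f => [|m IHm] f lemn szf.
  exists (fun=> 0); split=> //; rewrite big1 => [|j _]; last by rewrite scale0r.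
  by apply/eqP; rewrite -size_poly_eq0 -leqn0.
pose i := Ordinal lemn.
have [mon sz] := gq i.
have sz' : (size (f - f`_m *: q i)%R <= m)%N.
  apply/leq_sizeP => j; rewrite leq_eqVlt => /predU1P[<-|ltmj].
    rewrite coefB coefZ; move: mon; rewrite monicE lead_coefE sz /= => /eqP->.
    by rewrite mulr1 subrr.
  rewrite coefB coefZ [f`_j]nth_default ?(leq_trans szf) //.
  by rewrite [_`_j]nth_default ?sz // mulr0 subr0.
have [c [c0 /eqP]] := IHm _ (ltnW lemn) sz'.
rewrite subr_eq => /eqP def_f.
exists (fun j => c j + (if j == i then f`_m else 0)); split=> [j ltmj|].
  rewrite c0 ?(ltnW ltmj) // add0r; case: eqP ltmj => // ->.
  by rewrite /= ltnn.
rewrite [LHS]def_f; under [RHS]eq_bigr do rewrite scalerDl.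
rewrite big_split /=; congr (_ + _).
rewrite (bigD1 i) //= eqxx big1 ?addr0 // => j.
by move/negPf->; rewrite scale0r.
Qed.

Lemma graded_change p q : graded p -> graded q ->
  exists D : 'M[F]_n, [/\ is_trig_mx D^T, forall k, D k k = 1
    & forall k, p k = \sum_j D j k *: q j].
Proof.
move=> gp gq.
have /choice[c cP] (k : 'I_n) : exists c : 'I_n -> F,
    [/\ forall j : 'I_n, (k < j)%N -> c j = 0, c k = 1
      & p k = \sum_j c j *: q j].
  have [[monp szp] [monq szq]] := (gp k, gq k).
  have szB : (size (p k - q k)%R <= k)%N.
    apply/leq_sizeP => j; rewrite leq_eqVlt => /predU1P[<-|ltkj].
      move: monp monq; rewrite !monicE !lead_coefE szp szq /= coefB.
      by move=> /eqP-> /eqP->; rewrite subrr.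
    by rewrite coefB !nth_default ?subrr ?szp ?szq.
  have [c [c0 /eqP]] := graded_span gq (ltnW (ltn_ord k)) szB.
  rewrite subr_eq => /eqP def_p.
  exists (fun j => c j + (j == k)%:R); split=> [j ltkj||].
  - rewrite c0 ?(ltnW ltkj) // add0r; case: eqP ltkj => // ->.
    by rewrite ltnn.
  - by rewrite c0 // eqxx add0r.
  rewrite def_p; under [RHS]eq_bigr do rewrite scalerDl.
  rewrite big_split /=; congr (_ + _).
  rewrite (bigD1 k) //= eqxx scale1r big1 ?addr0 // => j /negPf->.
  by rewrite scale0r.
exists (\matrix_(j, k) c k j); split=> [|k|k].
- by apply/is_trig_mxP => i j ltij; have [c0 _ _] := cP i; rewrite !mxE c0.
- by rewrite mxE; case: (cP k).
- by under eq_bigr do rewrite mxE; case: (cP k).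
Qed.
End Graded.

Section Newton.
Variables (F : fieldType) (n : nat) (mu : 'I_n -> F).

Definition newton (k : nat) : {poly F} :=
  \prod_(j < n | (j < k)%N) ('X - (mu j)%:P).

Lemma newtonS (k : 'I_n) : newton k.+1 = newton k * ('X - (mu k)%:P).
Proof.
rewrite /newton (bigD1 k) //= mulrC; congr (_ * _); apply: eq_bigl => j.
by rewrite ltnS ltn_neqAle -val_eqE andbC.
Qed.

Lemma horner_newton k (z : F) :
  (newton k).[z] = \prod_(j < n | (j < k)%N) (z - mu j).
Proof. by rewrite horner_prod; apply: eq_bigr => j _; rewrite hornerXsubC. Qed.

Lemma newton_node (k : nat) (i : 'I_n) : (i < k)%N -> (newton k).[mu i] = 0.
Proof. by move=> ltik; rewrite horner_newton (bigD1 i) //= subrr mul0r. Qed.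

Lemma newton_neq0 (k : 'I_n) : injective mu -> (newton k).[mu k] != 0.
Proof.
move=> injmu; rewrite horner_newton; apply/prodf_neq0 => j ltjk.
rewrite subr_eq0 (inj_eq injmu); apply: contraTneq ltjk => ->.
by rewrite ltnn.
Qed.

(** Together with the next family of polynomials this gives, through
    [graded_change], the unitriangular passage between the orthogonal and the
    Newton bases. *)
Lemma newton_graded : graded (fun k : 'I_n => newton k).
Proof.
suff H m : (m <= n)%N -> newton m \is monic /\ size (newton m) = m.+1.
  by move=> k; apply: H; exact: ltnW.
elim: m => [|m IHm] lemn.
  by rewrite /newton big1 ?monic1 ?size_poly1.
have [mon sz] := IHm (ltnW lemn).
rewrite (newtonS (Ordinal lemn)) /= monicMl ?monicXsubC //; split=> //.
by rewrite size_Mmonic ?monicXsubC ?monic_neq0 // sz size_XsubC addn2.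
Qed.

End Newton.

Section JacobiPolynomials.
Variables (F : realFieldType) (n : nat) (a b : nat -> F).

(** At [k = 0] the predecessor of the index is again [0]; the recursion is the
    three-term recurrence as soon as [b 0 = 0]. *)
Fixpoint jpoly (k : nat) : {poly F} :=
  if k is k'.+1 then ('X - (a k')%:P) * jpoly k' - b k' *: jpoly k'.-1 else 1.

Lemma jpolyS k :
  jpoly k.+1 = ('X - (a k)%:P) * jpoly k - b k *: jpoly k.-1.
Proof. by []. Qed.

Lemma horner_jpolyS k (z : F) :
  (jpoly k.+1).[z] = (z - a k) * (jpoly k).[z] - b k * (jpoly k.-1).[z].
Proof. by rewrite jpolyS !hornerE. Qed.

Lemma jpoly_monic_size k : jpoly k \is monic /\ size (jpoly k) = k.+1.
Proof.
elim/ltn_ind: k => -[_|k IHk]; first by rewrite monic1 size_poly1.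
have [mon sz] := IHk k (ltnSn k).
have [_ szp] := IHk k.-1 (leq_pred k).
have monX : ('X - (a k)%:P) * jpoly k \is monic by rewrite monicMl ?monicXsubC.
have szX : size (('X - (a k)%:P) * jpoly k) = k.+2.
  by rewrite size_monicM ?monicXsubC ?monic_neq0 // sz size_XsubC.
have szlt : (size (- (b k *: jpoly k.-1))%R < k.+2)%N.
  rewrite size_polyN (leq_ltn_trans (size_scale_leq _ _)) // szp !ltnS.
  exact: leq_pred.
rewrite jpolyS monicE lead_coefDl ?szX // size_polyDl ?szX //.
Qed.

Lemma jpoly_graded : graded (fun k : 'I_n => jpoly k).
Proof. by move=> k; exact: jpoly_monic_size. Qed.

Variable E : nat -> F.
Hypothesis E_gt0 : forall k, 0 < E k.
Hypothesis b0 : b 0%N = 0.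
Hypothesis bE : forall k, (k.+1 < n)%N -> b k.+1 * E k.+1 = E k.

(** By the recurrence each summand, multiplied by [x - y], is a difference of
    two consecutive right-hand sides. *)
Lemma christoffel_darboux (x y : F) m : (m <= n)%N ->
  (x - y) * (\sum_(k < m) E k * (jpoly k).[x] * (jpoly k).[y]) =
  E m.-1 * ((jpoly m).[x] * (jpoly m.-1).[y]
            - (jpoly m.-1).[x] * (jpoly m).[y]).
Proof.
elim: m => [|m IHm] lemn; first by rewrite big_ord0 /= mulr0 subrr mulr0.
rewrite big_ord_recr [m.+1.-1]/= -/(jpoly m.+1) !horner_jpolyS mulrDr.
rewrite {}IHm 1?ltnW //.
have [->|m_gt0] := posnP m; first by rewrite b0 /= -polyC1 !hornerC; ring.
rewrite /=.
by rewrite -[E m.-1]bE ?prednK //; ring.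
Qed.

(** The reciprocal of the Christoffel number, i.e., of the mass of the spectral
    measure at a root [z] of [jpoly n]. *)
Definition christoffel (z : F) := \sum_(k < n) E k * (jpoly k).[z] ^+ 2.

Lemma christoffel_gt0 z : (0 < n)%N -> 0 < christoffel z.
Proof.
move=> n_gt0; rewrite /christoffel (bigD1 (Ordinal n_gt0)) //=.
rewrite -polyC1 hornerC expr1n mulr1.
apply: ltr_pwDl => //; apply: sumr_ge0 => i _.
by rewrite mulr_ge0 ?sqr_ge0 // ltW.
Qed.

Variable mu : 'I_n -> F.
Hypothesis mu_inj : injective mu.
Hypothesis mu_root : forall i, (jpoly n).[mu i] = 0.

Let V : 'M[F]_n := \matrix_(i, k) (jpoly k).[mu i].
Let DE : 'rV[F]_n := \row_k E k.
Let DG : 'rV[F]_n := \row_k christoffel (mu k).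
Let inv_row (v : 'rV[F]_n) : 'rV[F]_n := \row_k (v 0 k)^-1.

Let chr_gt0 i : 0 < christoffel (mu i).
Proof. by apply: christoffel_gt0; apply: leq_ltn_trans (ltn_ord i). Qed.

Lemma jpoly_rows_orthogonal : V *m diag_mx DE *m V^T = diag_mx DG.
Proof.
apply/matrixP => i j; rewrite !mxE mul_mx_diag.
under eq_bigr do rewrite !mxE.
have [<-|neqij] := eqVneq i j.
  by rewrite mulr1n; apply: eq_bigr => k _; ring.
rewrite mulr0n; have := christoffel_darboux (mu i) (mu j) (leqnn n).
rewrite !mu_root mul0r mulr0 subr0 mulr0 => /eqP.
rewrite mulf_eq0 subr_eq0 (inj_eq mu_inj) (negPf neqij) /= => /eqP sum0.
by rewrite -[RHS]sum0; apply: eq_bigr => k _; ring.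
Qed.

Lemma diag_mxV (v : 'rV[F]_n) : (forall k, v 0 k != 0) ->
  diag_mx v *m diag_mx (inv_row v) = 1%:M.
Proof.
move=> v_neq0; rewrite mulmx_diag; apply/matrixP => i j; rewrite !mxE.
by case: eqP => // _; rewrite mulfV.
Qed.

(** A one-sided inverse of a square matrix is two-sided, so orthogonality of
    the rows (eigenvectors for different eigenvalues) becomes orthogonality of
    the columns: the polynomials are orthogonal for the measure with masses
    [1 / christoffel], and their squared norms are [1 / E k]. *)
Lemma jpoly_cols_orthogonal :
  V^T *m diag_mx (inv_row DG) *m V = diag_mx (inv_row DE).
Proof.
have DEV : diag_mx DE *m diag_mx (inv_row DE) = 1%:M.
  by apply: diag_mxV => k; rewrite mxE gt_eqF.
have DGV : diag_mx DG *m diag_mx (inv_row DG) = 1%:M.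
  by apply: diag_mxV => k; rewrite mxE gt_eqF.
have /mulmx1C : V *m diag_mx DE *m (V^T *m diag_mx (inv_row DG)) = 1%:M.
  by rewrite mulmxA jpoly_rows_orthogonal.
rewrite mulmxA => /(congr1 (mulmx^~ (diag_mx (inv_row DE)))).
by rewrite /= -[LHS]mulmxA DEV mulmx1 mul1mx.
Qed.

Let N : 'M[F]_n := \matrix_(i, k) (newton mu k).[mu i].

Lemma newton_jpoly : exists2 C : 'M[F]_n,
  is_trig_mx C^T /\ (forall k, C k k = 1) & N = V *m C.
Proof.
have [C [trigC C1 def_q]] := graded_change (newton_graded mu) jpoly_graded.
exists C => //; apply/matrixP => i k; rewrite !mxE def_q horner_sum.
by apply: eq_bigr => j _; rewrite hornerZ !mxE mulrC.
Qed.

(** Minimality of the orthogonal polynomial: a monic polynomial of degree [k]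
    is [jpoly k] plus an orthogonal combination of the lower ones. *)
Lemma newton_norm_ge (k : 'I_n) :
  (E k)^-1 <= \sum_i (newton mu k).[mu i] ^+ 2 / christoffel (mu i).
Proof.
have [C [_ C1] defN] := newton_jpoly.
have : N^T *m diag_mx (inv_row DG) *m N = C^T *m diag_mx (inv_row DE) *m C.
  by rewrite -jpoly_cols_orthogonal defN trmx_mul !mulmxA.
move=> /matrixP/(_ k k); rewrite !mxE !mul_mx_diag.
under eq_bigr do rewrite !mxE.
under [in RHS]eq_bigr do rewrite !mxE.
rewrite (eq_bigr (fun i => (newton mu k).[mu i] ^+ 2 / christoffel (mu i)));
  last by move=> i _; ring.
move=> ->; rewrite (bigD1 k) //= C1 mul1r mulr1 lerDl.
apply: sumr_ge0 => i _; rewrite mulrAC -expr2 mulr_ge0 ?sqr_ge0 //.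
by rewrite invr_ge0 ltW.
Qed.

(** A unitriangular change of basis preserves the Gram determinant, and the
    matrix of values of the Newton basis at its own nodes is triangular. *)
Lemma newton_det :
  \prod_(i < n) ((newton mu i).[mu i] ^+ 2 / christoffel (mu i)) =
  \prod_(k < n) (E k)^-1.
Proof.
have [C [trigC C1] defN] := newton_jpoly.
have detC : \det C = 1 by rewrite -det_tr det_trig // big1 // => i; rewrite mxE.
have trigN : is_trig_mx N.
  by apply/is_trig_mxP => i j ltij; rewrite mxE newton_node.
have detN : \det N = \prod_(i < n) (newton mu i).[mu i].
  by rewrite det_trig //; apply: eq_bigr => i _; rewrite mxE.
have detNV : \det N = \det V by rewrite defN det_mulmx detC mulr1.
have := congr1 determinant jpoly_cols_orthogonal.
rewrite !det_mulmx det_tr -detNV detN !det_diag mulrAC -expr2.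
rewrite -prodrXl -big_split /= => detE.
transitivity (\prod_(k < n) inv_row DE 0 k); last first.
  by apply: eq_bigr => k _; rewrite !mxE.
by rewrite -detE; apply: eq_bigr => i _; rewrite !mxE.
Qed.

End JacobiPolynomials.

(** * Evolution of the spectral data along the Toda flow *)

Section Derive.
Variable R : realType.
Implicit Types (f g : R -> R) (t df dg c : R).

Lemma is_derive_sub f g t df dg : is_derive t 1 f df -> is_derive t 1 g dg ->
  is_derive t 1 (fun s => f s - g s) (df - dg).
Proof. by move=> ? ?; exact: is_deriveB. Qed.

Lemma is_derive_mul f g t df dg : is_derive t 1 f df -> is_derive t 1 g dg ->
  is_derive t 1 (fun s => f s * g s) (df * g t + f t * dg).
Proof.
move=> fd gd; have H := is_deriveM fd gd.
by apply: (is_derive_eq H); rewrite /GRing.scale /= addrC mulrC.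
Qed.

Lemma is_derive_scale c f t df : is_derive t 1 f df ->
  is_derive t 1 (fun s => c * f s) (c * df).
Proof.
move=> fd; apply: is_derive_eq (is_derive_mul (is_derive_cst c t 1) fd) _.
by rewrite mul0r add0r.
Qed.

Lemma is_derive_exp f t df : is_derive t 1 f df ->
  is_derive t 1 (fun s => expR (f s)) (df * expR (f t)).
Proof.
move=> fd; have H := is_derive1_comp (is_derive_expR (f t)) fd.
by apply: (is_derive_eq H); rewrite mulrC.
Qed.

Lemma is_derive_bigsum n (h : 'I_n -> R -> R) t (dh : 'I_n -> R) :
  (forall i, is_derive t 1 (h i) (dh i)) ->
  is_derive t 1 (fun s => \sum_i h i s) (\sum_i dh i).
Proof.
move=> hd; rewrite (_ : (fun s => _) = \sum_i h i); first exact: is_derive_sum.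
by apply/funext => s; rewrite fct_sumE.
Qed.

End Derive.

Section Toda.
Variables (R : realType) (n : nat).
Implicit Types (v w : 'rV[R]_n) (t z : R).

(** Reading vectors at natural numbers spares bound proofs in the recurrences.
    The value 0 beyond the last particle makes the last eigenvector equation an
    instance of the recurrence. *)
Definition ext v (k : nat) : R := if insub k is Some i then v 0 i else 0.

Lemma ext_ord v (i : 'I_n) : ext v i = v 0 i.
Proof. by rewrite /ext valK. Qed.

Definition diag_entry w k : R := - (ext w k / 2).

Definition offdiag_sqr v k : R :=
  if (0 < k < n)%N then expR (ext v k.-1 - ext v k) / 4 else 0.

(** Its reciprocal is the squared norm of the [k]-th orthogonal polynomial, in
    the normalization of the spectral measure in which the masses evolve
    exponentially. *)
Definition inv_norm v k : R := 4 ^+ k * expR (ext v k).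

Lemma offdiag_sqr0 v : offdiag_sqr v 0 = 0. Proof. by []. Qed.

Lemma offdiag_sqr_ge v k : (n <= k)%N -> offdiag_sqr v k = 0.
Proof.
by move=> lenk; rewrite /offdiag_sqr [(k < n)%N]ltnNge lenk andbF.
Qed.

Lemma inv_norm_gt0 v k : 0 < inv_norm v k.
Proof. by rewrite mulr_gt0 ?expR_gt0 // exprn_gt0. Qed.

Lemma offdiag_inv_norm v k : (k.+1 < n)%N ->
  offdiag_sqr v k.+1 * inv_norm v k.+1 = inv_norm v k.
Proof.
move=> ltkn; rewrite /offdiag_sqr /inv_norm /= ltkn exprS expRB.
have := expR_gt0 (ext v k.+1); move: (expR _) => e e_gt0.
by field; rewrite gt_eqF.
Qed.

Lemma sum_ord_pred (k : 'I_n) (f : nat -> R) :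
  \sum_(j < n | j.+1 == k :> nat) f j = if (0 < k)%N then f k.-1 else 0.
Proof.
case: posnP => [k0|k_gt0]; first by rewrite big_pred0 // => j; rewrite k0.
have ltk : (k.-1 < n)%N by rewrite (leq_ltn_trans (leq_pred k)).
rewrite (big_pred1 (Ordinal ltk)) // => j.
by rewrite /= -[_ == Ordinal ltk]val_eqE /= -{1}(prednK k_gt0) eqSS.
Qed.

Lemma sum_ord_succ (k : 'I_n) (f : nat -> R) :
  \sum_(j < n | k.+1 == j :> nat) f j = if (k.+1 < n)%N then f k.+1 else 0.
Proof.
case: ltnP => [ltk|lenk].
  by rewrite (big_pred1 (Ordinal ltk)) // => j; rewrite /= eq_sym.
rewrite big_pred0 // => j; apply/negbTE.
by rewrite neq_ltn (leq_trans (ltn_ord j)) ?orbT.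
Qed.

Lemma toda_forceE v (k : 'I_n) :
  toda_force v k = 4 * (offdiag_sqr v k - offdiag_sqr v k.+1).
Proof.
have in_ext (j : 'I_n) : expR (v 0 j - v 0 k) = expR (ext v j - ext v k).
  by rewrite !ext_ord.
have in_ext' (j : 'I_n) : expR (v 0 k - v 0 j) = expR (ext v k - ext v j).
  by rewrite !ext_ord.
rewrite /toda_force (eq_bigr _ (fun j _ => in_ext j)).
rewrite [X in _ - X](eq_bigr _ (fun j _ => in_ext' j)).
rewrite (sum_ord_pred k (fun j => expR (ext v j - ext v k))).
rewrite (sum_ord_succ k (fun j => expR (ext v k - ext v j))).
rewrite /offdiag_sqr ltn_ord andbT /=.
by case: ifP => _; case: ifP => _; field.
Qed.

Definition flaschka_poly v w := jpoly (diag_entry w) (offdiag_sqr v).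

Definition spectral_norm v w z : R :=
  christoffel n (diag_entry w) (offdiag_sqr v) (inv_norm v) z.

Lemma spectral_norm_gt0 v w z : (0 < n)%N -> 0 < spectral_norm v w z.
Proof. by apply: christoffel_gt0; exact: inv_norm_gt0. Qed.

Variables x y : R -> 'rV[R]_n.
Hypothesis sol : toda_solution x y.

Lemma is_derive_ext t k : is_derive t 1 (fun s => ext (x s) k) (ext (y t) k).
Proof.
rewrite /ext; case: insub => [i|]; first by have [] := sol t i.
exact: is_derive_cst.
Qed.

Lemma is_derive_inv_norm t k : is_derive t 1 (fun s => inv_norm (x s) k)
  (- 2 * diag_entry (y t) k * inv_norm (x t) k).
Proof.
apply: is_derive_eq (is_derive_scale _ (is_derive_exp (is_derive_ext t k))) _.
by rewrite /diag_entry /inv_norm; field.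
Qed.

Lemma is_derive_diag_entry t k : is_derive t 1 (fun s => diag_entry (y s) k)
  (2 * (offdiag_sqr (x t) k.+1 - offdiag_sqr (x t) k)).
Proof.
rewrite /diag_entry /ext; case: insubP => [i _ def_k|].
  rewrite (_ : (fun s => _) = fun s => - 2^-1 * y s 0 i); last first.
    by apply/funext => s; ring.
  have [_ dy] := sol t i; apply: is_derive_eq (is_derive_scale _ dy) _.
  by rewrite toda_forceE def_k; field.
rewrite -leqNgt => lenk; apply: is_derive_eq (is_derive_cst _ _ _) _.
by rewrite !offdiag_sqr_ge ?subrr ?mulr0 // leqW.
Qed.

Lemma is_derive_offdiag_sqr t k : is_derive t 1 (fun s => offdiag_sqr (x s) k)
  (2 * offdiag_sqr (x t) k
     * (diag_entry (y t) k - diag_entry (y t) k.-1)).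
Proof.
rewrite /offdiag_sqr; case: ifP => _; last first.
  by apply: is_derive_eq (is_derive_cst _ _ _) _; rewrite mulr0 mul0r.
rewrite (_ : (fun s => _) =
    fun s => 4^-1 * expR (ext (x s) k.-1 - ext (x s) k)); last first.
  by apply/funext => s; rewrite mulrC.
apply: is_derive_eq
  (is_derive_scale _ (is_derive_exp (is_derive_sub _ _))) _.
- exact: is_derive_ext.
- exact: is_derive_ext.
- by rewrite /diag_entry; field.
Qed.

Let toda_poly t := flaschka_poly (x t) (y t).
Let toda_norm t := spectral_norm (x t) (y t).

(** Strong induction on [k]: differentiating the recurrence leaves a multiple
    of the recurrence one step below. *)
Lemma is_derive_toda_poly z t k : is_derive t 1 (fun s => (toda_poly s k).[z])
  (- 2 * offdiag_sqr (x t) k * (toda_poly t k.-1).[z]).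
Proof.
elim/ltn_ind: k => -[_|k IHk].
  apply: is_derive_eq (is_derive_cst _ _ _) _.
  by rewrite offdiag_sqr0 mulr0 mul0r.
rewrite (_ : (fun s => _) =
    fun s => (z - diag_entry (y s) k) * (toda_poly s k).[z]
             - offdiag_sqr (x s) k * (toda_poly s k.-1).[z]); last first.
  by apply/funext => s; rewrite /toda_poly /flaschka_poly horner_jpolyS.
have dP := IHk k (ltnSn k); have dP' := IHk k.-1 (leq_pred k).
apply: is_derive_eq (is_derive_sub
    (is_derive_mul (is_derive_sub (is_derive_cst z t 1)
                                  (is_derive_diag_entry t k)) dP)
    (is_derive_mul (is_derive_offdiag_sqr t k) dP')) _.
rewrite /=; case: k {IHk dP dP'} => [|k].
  by rewrite offdiag_sqr0 /cst /=; ring.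
by rewrite /cst /= /toda_poly /flaschka_poly horner_jpolyS /=; ring.
Qed.

(** Isospectrality: the last off-diagonal entry, at index [n], is zero. *)
Lemma toda_poly_const z t : (toda_poly t n).[z] = (toda_poly 0 n).[z].
Proof.
apply: (is_derive_0_is_cst (f := fun s => (toda_poly s n).[z])) => s.
apply: is_derive_eq (is_derive_toda_poly z s n) _.
by rewrite offdiag_sqr_ge // mulr0 mul0r.
Qed.

(** After elimination of the diagonal entries by the recurrence, what remains
    besides [- 2 z] times the sum is telescoping, and its end terms vanish: the
    first because [offdiag_sqr _ 0 = 0], the last because [z] is an
    eigenvalue. *)
Lemma is_derive_spectral_norm z t :
  (toda_poly 0 n).[z] = 0 ->
  is_derive t 1 (fun s => toda_norm s z)
    (- 2 * z * toda_norm t z).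
Proof.
move=> root_z; have := toda_poly_const z t; rewrite root_z.
set a := diag_entry (y t); set b := offdiag_sqr (x t).
set E := inv_norm (x t); rewrite /toda_poly /flaschka_poly -/a -/b => Pn0.
set P := fun k => (jpoly a b k).[z].
have PS k : P k.+1 = (z - a k) * P k - b k * P k.-1.
  exact: horner_jpolyS.
have telescope m : (m < n)%N ->
    \sum_(k < m.+1) (- 2 * a k * E k * P k ^+ 2
                     - 4 * b k * E k * P k * P k.-1) =
    - 2 * z * (\sum_(k < m.+1) E k * P k ^+ 2) + 2 * E m * P m.+1 * P m.
  elim: m => [|m IHm] ltmn.
    by rewrite !big_ord_recl !big_ord0 /= PS /= /b offdiag_sqr0; ring.
  rewrite big_ord_recr [in RHS]big_ord_recr /= {}IHm 1?ltnW // mulrDr /=.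
  rewrite -[E m](offdiag_inv_norm _ ltmn) -/b -/E (PS m.+1) /=.
  by ring.
have [n0|n_gt0] := posnP n.
  by move: Pn0; rewrite n0 /= -polyC1 hornerC => /eqP; rewrite oner_eq0.
rewrite /toda_norm /spectral_norm /christoffel.
have dsum : is_derive t 1
    (fun s => \sum_(k < n) inv_norm (x s) k * (toda_poly s k).[z] ^+ 2)
    (\sum_(k < n) (- 2 * a k * E k * P k ^+ 2 - 4 * b k * E k * P k * P k.-1)).
  apply: is_derive_bigsum => k.
  have dP := is_derive_toda_poly z t k.
  have := is_derive_mul (is_derive_inv_norm t k) (is_derive_mul dP dP).
  by move=> H; apply: (is_derive_eq H); rewrite -/a -/b -/E -/(P k) -/(P k.-1); ring.
apply: (is_derive_eq dsum).
have Pn : P n = 0 by [].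
rewrite -(prednK n_gt0) telescope ?prednK // -/E.
by rewrite Pn mulr0 mul0r addr0.
Qed.

Lemma spectral_norm_evolution z t : (toda_poly 0 n).[z] = 0 ->
  toda_norm t z = toda_norm 0 z * expR (- (2 * z * t)).
Proof.
move=> root_z.
suff : toda_norm t z * expR (2 * z * t)
          = toda_norm 0 z * expR (2 * z * 0).
  rewrite mulr0 expR0 mulr1 => <-.
  by rewrite -mulrA -expRD subrr expR0 mulr1.
apply: (is_derive_0_is_cst
  (f := fun s => toda_norm s z * expR (2 * z * s))) => s.
have := is_derive_mul (is_derive_spectral_norm s root_z)
  (is_derive_exp (is_derive_scale (2 * z) (is_derive_id s 1))).
by move=> H; apply: (is_derive_eq H); ring.
Qed.

End Toda.

(** * Asymptotics of the particles *)

Section Limits.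
Variables (R : realType) (T : Type) (F : set_system T).
Context {FF : Filter F}.

Lemma cvgD0 (f g : T -> R) : f t @[t --> F] --> (0 : R) ->
  g t @[t --> F] --> (0 : R) -> (f t + g t) @[t --> F] --> (0 : R).
Proof. by move=> f0 g0; rewrite -(addr0 (0 : R)); exact: cvgD. Qed.

Lemma cvgN0 (f : T -> R) : f t @[t --> F] --> (0 : R) ->
  (- f t) @[t --> F] --> (0 : R).
Proof. by move=> f0; rewrite -(@oppr0 R); exact: cvgN. Qed.

Lemma cvgMr0 (c : R) (f : T -> R) : f t @[t --> F] --> (0 : R) ->
  (c * f t) @[t --> F] --> (0 : R).
Proof. by move=> f0; rewrite -(mulr0 c); exact: cvgM (cvg_cst c) f0. Qed.

Lemma cvg_sum0 n (P : pred 'I_n) (f : 'I_n -> T -> R) :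
  (forall i, P i -> f i t @[t --> F] --> (0 : R)) ->
  (\sum_(i < n | P i) f i t) @[t --> F] --> (0 : R).
Proof.
move=> f0; elim: (index_enum _) => [|i r IHr].
  rewrite (_ : (fun t => _) = fun=> 0); first exact: cvg_cst.
  by apply/funext => t; rewrite big_nil.
rewrite (_ : (fun t => _) = fun t => (if P i then f i t else 0)
    + \sum_(j <- r | P j) f j t); last first.
  by apply/funext => t; rewrite big_cons; case: ifP; rewrite ?add0r.
have fi0 : (if P i then f i t else 0) @[t --> F] --> (0 : R).
  by case Pi: (P i); [exact: f0 | exact: cvg_cst].
by apply: cvgD0.
Qed.

(** A bound from above on each term of a zero sum is also a bound from below:
    [f i] is minus the sum of the others. *)
Lemma cvg0_sum0_bounded n (f w : 'I_n -> T -> R) :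
  (forall i t, f i t <= w i t) -> (forall t, \sum_i f i t = 0) ->
  (forall i, w i t @[t --> F] --> (0 : R)) ->
  forall i, f i t @[t --> F] --> (0 : R).
Proof.
move=> lefw sumf w0 i.
apply: (@squeeze_cvgr _ F _ _ (fun t => - \sum_(j < n | j != i) w j t) (w i)).
- apply: nearW => t; rewrite lefw andbT lerNl.
  have /eqP := sumf t; rewrite (bigD1 i) //= addrC addr_eq0 => /eqP <-.
  by apply: ler_sum => j _.
- by apply: cvgN0; exact: cvg_sum0.
- exact: w0.
Qed.

End Limits.

Section Exponential.
Variable R : realType.

Lemma cvg_expR_linear_pinfty (c : R) : c < 0 ->
  expR (c * t) @[t --> +oo] --> (0 : R).
Proof.
move=> c_lt0; have Nc_gt0 : 0 < - c by rewrite oppr_gt0.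
rewrite (_ : (fun t => _) = (fun u => expR (- u)) \o (fun t : R => t * - c)).
  by apply: cvg_comp (gt0_cvgMly Nc_gt0 cvg_id) _; exact: cvgr_expR.
by apply/funext => t /=; congr expR; ring.
Qed.

Lemma cvg_expR_linear_ninfty (c : R) : 0 < c ->
  expR (c * t) @[t --> -oo] --> (0 : R).
Proof.
move=> c_gt0; apply/cvgNy_compNP.
have Nc : - c < 0 by rewrite oppr_lt0.
rewrite (_ : _ \o _ = fun t => expR (- c * t)).
  exact: cvg_expR_linear_pinfty.
by apply/funext => t /=; congr expR; ring.
Qed.

(** The slope is the difference of the values at [t + 1] and [t]. *)
Lemma affine_cvg0_pinfty (c d : R) :
  (c * t + d) @[t --> +oo] --> (0 : R) -> c = 0 /\ d = 0.
Proof.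
move=> H; have c0 : c = 0.
  have H1 : (c * (t + 1) + d) @[t --> +oo] --> (0 : R).
    rewrite (_ : (fun t => _) = (fun t => (fun u => c * u + d) (t + 1))) //.
    by rewrite (@cvg_shiftr R 1 R (fun u => c * u + d)).
  have : ((c * (t + 1) + d) - (c * t + d)) @[t --> +oo] --> (0 : R).
    by rewrite -(subrr (0 : R)); exact: cvgB.
  rewrite (_ : (fun t => _ ) = fun=> c); last by apply/funext => t /=; ring.
  by move=> /(cvg_lim (@Rhausdorff R)) <-; rewrite lim_cst.
split=> //; move: H; rewrite c0.
rewrite (_ : (fun t => _ ) = fun=> d); last by apply/funext => t /=; ring.
by move=> /(cvg_lim (@Rhausdorff R)) <-; rewrite lim_cst.
Qed.

Lemma affine_cvg0_ninfty (c d : R) :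
  (c * t + d) @[t --> -oo] --> (0 : R) -> c = 0 /\ d = 0.
Proof.
move=> /cvgNy_compNP.
rewrite (_ : _ \o _ = fun t => - c * t + d).
  by case/affine_cvg0_pinfty => /eqP; rewrite oppr_eq0 => /eqP.
by apply/funext => t /=; ring.
Qed.

End Exponential.

Section Asymptotics.
Variables (R : realType) (n : nat).
Implicit Types (v w : 'rV[R]_n) (t z : R) (mu : 'I_n -> R).

Lemma ln_prod (I : finType) (P : pred I) (f : I -> R) :
  (forall i, P i -> 0 < f i) ->
  ln (\prod_(i | P i) f i) = \sum_(i | P i) ln (f i).
Proof.
move=> f_gt0.
suff [] : 0 < \prod_(i | P i) f i /\
    ln (\prod_(i | P i) f i) = \sum_(i | P i) ln (f i) by [].
elim/big_rec2: _ => [|i p s Pi [p_gt0 lnp]]; first by rewrite ln1 ltr01.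
by rewrite mulr_gt0 ?f_gt0 // lnM ?posrE ?f_gt0 // lnp.
Qed.

(** The factor of [exp (2 mu_k t)] in the dominant term of the squared norm of
    the [k]-th orthogonal polynomial. *)
Definition asym_weight v w mu (k : 'I_n) : R :=
  (newton mu k).[mu k] ^+ 2 / spectral_norm v w (mu k).

Definition asym_phase v w mu (k : 'I_n) : R :=
  - ln (asym_weight v w mu k) - 2 * k%:R * ln 2.

Lemma ord_pos (k : 'I_n) : (0 < n)%N.
Proof. exact: leq_ltn_trans (ltn_ord k). Qed.

Lemma asym_weight_gt0 v w mu k : injective mu -> 0 < asym_weight v w mu k.
Proof.
move=> mu_inj; rewrite divr_gt0 ?spectral_norm_gt0 ?(ord_pos k) //.
by rewrite exprn_even_gt0 // newton_neq0.
Qed.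

Lemma ln_inv_norm v (k : 'I_n) :
  ln (inv_norm v k)^-1 = - (2 * k%:R * ln 2) - v 0 k.
Proof.
rewrite lnV ?posrE ?inv_norm_gt0 // lnM ?posrE ?expR_gt0 ?exprn_gt0 //.
rewrite lnXn // expRK ext_ord (_ : 4 = 2 ^+ 2 :> R) ?lnXn //; last by ring.
by ring.
Qed.

Variables x y : R -> 'rV[R]_n.
Hypothesis sol : toda_solution x y.
Variable mu : 'I_n -> R.
Hypothesis mu_inj : injective mu.
Hypothesis mu_root : forall i, (flaschka_poly (x 0) (y 0) n).[mu i] = 0.

Let lead := asym_weight (x 0) (y 0) mu.

Let lead_gt0 k : 0 < lead k. Proof. exact: asym_weight_gt0. Qed.

Let mu_root_t t i : (flaschka_poly (x t) (y t) n).[mu i] = 0.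
Proof. by rewrite -(mu_root i); exact: toda_poly_const. Qed.

Let defect (k : 'I_n) t : R :=
  ln (inv_norm (x t) k)^-1 - ln (lead k) - 2 * mu k * t.

Let defectE k t :
  defect k t = - (x t 0 k - (- 2 * mu k) * t - asym_phase (x 0) (y 0) mu k).
Proof. by rewrite /defect ln_inv_norm /asym_phase -/(lead k); ring. Qed.

Let norm_evolution t i : (spectral_norm (x t) (y t) (mu i))^-1 =
  (spectral_norm (x 0) (y 0) (mu i))^-1 * expR (2 * mu i * t).
Proof.
by rewrite (spectral_norm_evolution sol) // invfM expRN invrK.
Qed.

Let sum_defect t : \sum_k defect k t = 0.
Proof.
have lt0 k : 0 < lead k * expR (2 * mu k * t) by rewrite mulr_gt0 ?expR_gt0.
have : \prod_(k < n) (lead k * expR (2 * mu k * t)) =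
       \prod_(k < n) (inv_norm (x t) k)^-1.
  rewrite -(newton_det (inv_norm_gt0 (x t)) (offdiag_sqr0 (x t))
     (@offdiag_inv_norm _ _ (x t)) mu_inj (mu_root_t t)).
  apply: eq_bigr => i _; rewrite -/(spectral_norm (x t) (y t) (mu i)).
  by rewrite norm_evolution mulrA.
move=> /(congr1 (@ln R)); rewrite !ln_prod // => [prodE|k]; last first.
  by rewrite invr_gt0 inv_norm_gt0.
rewrite /defect; under eq_bigr do rewrite -addrA -opprD.
rewrite sumrB -prodE -sumrB big1 // => k _.
by rewrite lnM ?posrE ?expR_gt0 // expRK subrr.
Qed.

(** The Gram determinant identity at time 0: the phases carry the center of
    mass exactly, not only in the limit. *)
Lemma sum_asym_phase :
  \sum_k asym_phase (x 0) (y 0) mu k = \sum_k x 0 0 k.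
Proof.
have := sum_defect 0; under eq_bigr do rewrite defectE mulr0 subr0 opprB.
by rewrite sumrB => /eqP; rewrite subr_eq0 => /eqP.
Qed.

Variable F : set_system R.
Context {FF : Filter F}.
Hypothesis decay : forall i j : 'I_n, (i < j)%N ->
  expR (2 * (mu j - mu i) * t) @[t --> F] --> (0 : R).

(** The [defect] is the logarithm of the ratio of the squared norm to its
    dominant term.  The defects add up to zero by the determinant identity, and
    the test polynomial [newton mu k] bounds each by a combination of the
    decaying exponentials, through [1 + u <= exp u]. *)
Lemma toda_asymptoticsP (k : 'I_n) :
  (x t 0 k - (- 2 * mu k) * t - asym_phase (x 0) (y 0) mu k) @[t --> F]
    --> (0 : R).
Proof.
pose coef (i j : 'I_n) :=
  (newton mu i).[mu j] ^+ 2 / spectral_norm (x 0) (y 0) (mu j) / lead i.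
pose u (i : 'I_n) t :=
  \sum_(j < n | (i < j)%N) coef i j * expR (2 * (mu j - mu i) * t).
rewrite (_ : (fun t => _) = fun t => - defect k t); last first.
  by apply/funext => t; rewrite defectE opprK.
apply: cvgN0.
apply: (@cvg0_sum0_bounded _ _ F _ _ defect u) => [i t|t|i]; last first.
- by apply: cvg_sum0 => j ltij; apply: cvgMr0; exact: decay.
- exact: sum_defect.
rewrite /defect !lerBlDr -[leRHS]expRK ler_ln ?posrE ?expR_gt0 //; last first.
  by rewrite invr_gt0 inv_norm_gt0.
rewrite -addrA expRD; set e := expR (_ + _).
have -> : e = expR (2 * mu i * t) * lead i.
  by rewrite /e expRD lnK ?posrE.
apply: le_trans (newton_norm_ge (inv_norm_gt0 (x t)) (offdiag_sqr0 (x t))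
     (@offdiag_inv_norm _ _ (x t)) mu_inj (mu_root_t t) i) _.
have leE : (1 + u i t) * (expR (2 * mu i * t) * lead i)
           <= expR (u i t) * (expR (2 * mu i * t) * lead i).
  by rewrite ler_wpM2r ?expR_ge1Dx // mulr_ge0 ?expR_ge0 // ltW.
apply: le_trans leE; rewrite le_eqVlt; apply/orP; left; apply/eqP.
(* The terms before [i] vanish, and the term [i] is the dominant one. *)
rewrite (bigID (fun j : 'I_n => (i < j)%N)) /= addrC (bigD1 i) ?ltnn //=.
rewrite big1 ?addr0 => [|j /andP[leji neqji]]; last first.
  rewrite newton_node ?expr0n ?mul0r //.
  by rewrite ltn_neqAle neqji leqNgt.
rewrite mulrDl mul1r; congr (_ + _).
  rewrite -/(spectral_norm (x t) (y t) (mu i)) norm_evolution.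
  by rewrite mulrA mulrC.
rewrite /u mulr_suml; apply: eq_bigr => j _.
rewrite -/(spectral_norm (x t) (y t) (mu j)) norm_evolution /coef.
have -> : 2 * mu j * t = 2 * (mu j - mu i) * t + 2 * mu i * t by ring.
rewrite expRD; have := lead_gt0 i; move: (lead i) => l l_gt0.
have := @spectral_norm_gt0 R n (x 0) (y 0) (mu j) (ord_pos i).
move: (spectral_norm _ _ _) => g g_gt0.
by field; rewrite !gt_eqF.
Qed.

End Asymptotics.

(** * Eigenvectors of the Flaschka matrix *)

Section Eigenvectors.
Variables (R : realType) (n : nat).
Implicit Types (v w u : 'rV[R]_n) (z : R).

(** The diagonal scaling under which the symmetric matrix becomes the monic
    three-term recurrence. *)
Definition inv_norm_sqrt v k : R := 2 ^+ k * expR (ext v k / 2).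

Lemma inv_norm_sqrt_gt0 v k : 0 < inv_norm_sqrt v k.
Proof. by rewrite mulr_gt0 ?expR_gt0 // exprn_gt0. Qed.

Lemma inv_norm_sqrt_sqr v k : inv_norm_sqrt v k ^+ 2 = inv_norm v k.
Proof.
rewrite /inv_norm_sqrt /inv_norm exprMn -exprM mulnC exprM.
rewrite (_ : 2 ^+ 2 = 4 :> R); last by ring.
by rewrite expr2 -expRD; congr (_ * expR _); field.
Qed.

Lemma mul_flaschka u v w (k : 'I_n) :
  let p j := ext u j / inv_norm_sqrt v j in
  (u *m flaschka v w) 0 k = inv_norm_sqrt v k
     * (offdiag_sqr v k * p k.-1 + diag_entry w k * p k + p k.+1).
Proof.
move=> p; rewrite mxE.
have splitJ (j : 'I_n) : flaschka v w j k =
    (if j == k then - (w 0 k / 2) else 0)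
  + (if j.+1 == k :> nat then expR ((v 0 j - v 0 k) / 2) / 2 else 0)
  + (if k.+1 == j :> nat then expR ((v 0 k - v 0 j) / 2) / 2 else 0).
  rewrite mxE; have [->|neqjk] := eqVneq j k.
    by rewrite (gtn_eqF (ltnSn k)) !addr0.
  case: eqP => [jk|_]; last by rewrite !add0r.
  by rewrite add0r ifF ?addr0 // -jk gtn_eqF.
under eq_bigr do rewrite splitJ !mulrDr.
rewrite !big_split /=.
under eq_bigr do rewrite (fun_if (fun e => u 0 _ * e)) mulr0.
rewrite -big_mkcond big_pred1_eq.
under [X in _ + X + _ = _]eq_bigr do rewrite (fun_if (fun e => u 0 _ * e)) mulr0.
under [X in _ + X = _]eq_bigr do rewrite (fun_if (fun e => u 0 _ * e)) mulr0.
rewrite -!big_mkcond /=.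
pose f j := ext u j * (expR ((ext v j - ext v k) / 2) / 2).
pose g j := ext u j * (expR ((ext v k - ext v j) / 2) / 2).
rewrite (eq_bigr (fun j : 'I_n => f j)) => [|j _]; last by rewrite /f !ext_ord.
rewrite [X in _ + X = _](eq_bigr (fun j : 'I_n => g j)) => [|j _]; last first.
  by rewrite /g !ext_ord.
rewrite sum_ord_pred sum_ord_succ /f /g.
have s_gt0 j := inv_norm_sqrt_gt0 v j.
have s_neq0 j : inv_norm_sqrt v j != 0 by rewrite gt_eqF.
have ratio i : expR ((ext v i - ext v i.+1) / 2) / 2 =
    inv_norm_sqrt v i / inv_norm_sqrt v i.+1.
  rewrite /inv_norm_sqrt mulrBl expRD expRN exprS.
  by field; rewrite ?gt_eqF ?expR_gt0 ?exprn_gt0.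
rewrite !mulrDr; congr (_ + _); last first.
  case: ltnP => [_|lenk]; last first.
    by rewrite /p {1}/ext insubF ?mul0r ?mulr0 // ltnNge lenk.
  by rewrite ratio /p; field.
rewrite addrC; congr (_ + _); last first.
  by rewrite /p -!ext_ord /diag_entry; field.
case: posnP => [->|k_gt0]; first by rewrite offdiag_sqr0 mul0r mulr0.
have := ratio k.-1; rewrite (prednK k_gt0) => ->.
have /mulIf := lt0r_neq0 (inv_norm_gt0 v k); apply.
have := @offdiag_inv_norm R n v k.-1; rewrite (prednK k_gt0) => /(_ (ltn_ord k)).
rewrite -!inv_norm_sqrt_sqr => bE.
rewrite [RHS](_ : _ =
  inv_norm_sqrt v k * p k.-1 * (offdiag_sqr v k * inv_norm_sqrt v k ^+ 2));
  last by ring.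
by rewrite bE /p; field; rewrite !s_neq0.
Qed.

(** An eigenvector is determined by its first coordinate, through the
    recurrence; the last eigenvector equation says that [z] is a root of the
    characteristic polynomial, unless the vector is zero. *)
Lemma eigen_coords u v w z : u *m flaschka v w = z *: u ->
  exists2 c, forall k : 'I_n,
      u 0 k = c * inv_norm_sqrt v k * (flaschka_poly v w k).[z]
    & c * (flaschka_poly v w n).[z] = 0.
Proof.
move=> eigu; pose p j := ext u j / inv_norm_sqrt v j.
have s_neq0 j : inv_norm_sqrt v j != 0 by rewrite gt_eqF ?inv_norm_sqrt_gt0.
have pS k : (k < n)%N ->
    p k.+1 = (z - diag_entry w k) * p k - offdiag_sqr v k * p k.-1.
  move=> ltkn; have := mul_flaschka u v w (Ordinal ltkn).
  rewrite -/p eigu mxE /= -ext_ord /= => eq_k.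
  have def_u : ext u k = inv_norm_sqrt v k * p k by rewrite /p mulrC divfK.
  move: eq_k; rewrite def_u mulrCA => /(mulfI (s_neq0 k)) eq_k.
  by rewrite mulrBl eq_k; ring.
have pE k : (k <= n)%N -> p k = p 0%N * (flaschka_poly v w k).[z].
  elim/ltn_ind: k => -[_ _|k IHk ltkn].
    by rewrite /flaschka_poly /= -polyC1 hornerC mulr1.
  rewrite pS // /flaschka_poly horner_jpolyS.
  have lekn := ltnW ltkn; have lek'n := leq_trans (leq_pred k) lekn.
  rewrite (IHk k) // (IHk k.-1) ?ltnS ?leq_pred // /flaschka_poly.
  by ring.
exists (p 0%N) => [k|].
  rewrite mulrAC -pE; last exact: ltnW.
  by rewrite /p ext_ord divfK.
by rewrite -pE // /p /ext insubF ?mul0r // ltnn.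
Qed.

Lemma eigenvalue_root v w z :
  eigenvalue (flaschka v w) z -> (flaschka_poly v w n).[z] = 0.
Proof.
case/eigenvalueP => u eigu u_neq0; have [c def_u /eqP] := eigen_coords eigu.
rewrite mulf_eq0 => /orP[/eqP c0|/eqP //]; case/eqP: u_neq0.
by apply/rowP => k; rewrite def_u c0 !mul0r mxE.
Qed.

Lemma root_eigenvector v w z : (flaschka_poly v w n).[z] = 0 ->
  let u : 'rV[R]_n :=
    \row_k (inv_norm_sqrt v k * (flaschka_poly v w k).[z]) in
  u *m flaschka v w = z *: u.
Proof.
move=> root_z u; apply/rowP => k; rewrite mul_flaschka.
have s_neq0 j : inv_norm_sqrt v j != 0 by rewrite gt_eqF ?inv_norm_sqrt_gt0.
have pE j : (j <= n)%N ->
    ext u j / inv_norm_sqrt v j = (flaschka_poly v w j).[z].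
  rewrite leq_eqVlt => /predU1P[->|ltjn].
    by rewrite root_z /ext insubF ?mul0r // ltnn.
  by rewrite (ext_ord u (Ordinal ltjn)) mxE /= mulrAC mulfV ?mul1r.
rewrite !pE ?ltn_ord //; try by rewrite ltnW.
  by rewrite !mxE /flaschka_poly horner_jpolyS; ring.
by rewrite (leq_trans (leq_pred k)) // ltnW.
Qed.

End Eigenvectors.

(** * LU factorization and bidiagonal coordinates *)

Section LU.
Variables (R : realType) (n : nat).
Implicit Types (A L U : 'M[R]_n).

Lemma mul_lower_unit L A (k i : 'I_n) : lower_unit L ->
  (L *m A) k i = \sum_(j < n | (j < k)%N) L k j * A j i + A k i.
Proof.
move=> [/is_trig_mxP trigL L1]; rewrite mxE (bigID (fun j : 'I_n => (j < k)%N)).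
congr (_ + _); rewrite (bigD1 k) ?ltnn //= L1 mul1r big1 ?addr0 // => j.
move=> /andP[lekj neqjk]; rewrite trigL ?mul0r //.
by rewrite ltn_neqAle eq_sym neqjk leqNgt.
Qed.

Lemma mul_upper A U (i k : 'I_n) : is_trig_mx U^T ->
  (A *m U) i k = \sum_(j < n | (j < k)%N) A i j * U j k + A i k * U k k.
Proof.
move=> /is_trig_mxP trigU; rewrite mxE (bigID (fun j : 'I_n => (j < k)%N)).
congr (_ + _); rewrite (bigD1 k) ?ltnn //= big1 ?addr0 // => j.
move=> /andP[lekj neqjk]; have := trigU k j; rewrite mxE => ->; rewrite ?mulr0 //.
by rewrite ltn_neqAle eq_sym neqjk leqNgt.
Qed.

(** Row [k] of the upper factor, then column [k] of the lower one, are
    determined by the preceding rows and columns. *)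
Lemma LU_unique L U K V : lower_unit L -> lower_unit K ->
  is_trig_mx U^T -> is_trig_mx V^T -> (forall i, U i i != 0) ->
  L *m U = K *m V -> L = K /\ U = V.
Proof.
move=> luL luK utU utV U_neq0 eqLU.
suff H m (k : 'I_n) : (k < m)%N ->
    (forall i, L i k = K i k) /\ (forall i, U k i = V k i).
  by split; apply/matrixP => i j;
     [case: (H j.+1 j (ltnSn j)) | case: (H i.+1 i (ltnSn i))].
elim: m k => // m IHm k ltkm.
have IHk (j : 'I_n) : (j < k)%N ->
    (forall i, L i j = K i j) /\ (forall i, U j i = V j i).
  by move=> ltjk; apply: IHm; apply: leq_trans ltjk _; rewrite -ltnS.
have eqU i : U k i = V k i.
  have := congr1 (fun M : 'M[R]_n => M k i) eqLU.
  rewrite /= !mul_lower_unit // (eq_bigr (fun j => K k j * V j i)).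
    by move/addrI.
  by move=> j /IHk[-> ->].
split=> // i; have := congr1 (fun M : 'M[R]_n => M i k) eqLU.
rewrite /= !mul_upper // (eq_bigr (fun j => K i j * V j k)).
  by move/addrI; rewrite -eqU => /(mulIf (U_neq0 k)).
by move=> j /IHk[-> ->].
Qed.

End LU.

Section Bidiagonal.
Variables (R : realType) (n : nat) (v w : 'rV[R]_n) (mu : 'I_n -> R).
Hypothesis mu_inj : injective mu.
Hypothesis mu_root : forall i, (flaschka_poly v w n).[mu i] = 0.

Let P (i k : 'I_n) : R := (flaschka_poly v w k).[mu i].
Let s := inv_norm_sqrt v.
Let q (i j : 'I_n) : R := (newton mu j).[mu i].
Let s_gt0 k : 0 < s k. Proof. exact: inv_norm_sqrt_gt0. Qed.

Definition scaled_eigenrows (sigma : 'I_n -> R) : 'M[R]_n :=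
  \matrix_(i, k) (sigma i * s k * P i k).

Definition newton_lower (sigma : 'I_n -> R) : 'M[R]_n :=
  \matrix_(i, j) (sigma i * q i j / (sigma j * q j j)).

Lemma newton_lower_unit sigma : (forall i, sigma i != 0) ->
  lower_unit (newton_lower sigma).
Proof.
move=> sigma_neq0; split.
  by apply/is_trig_mxP => i j ltij; rewrite mxE /q newton_node // mulr0 mul0r.
by move=> i; rewrite mxE mulfV // mulf_neq0 // newton_neq0.
Qed.

(** Newton interpolation at the nodes [mu] is Gaussian elimination: column [j]
    of the lower factor holds the values of [newton mu j], which vanishes at
    the nodes before [mu j], and the upper factor holds the coordinates of the
    orthogonal polynomials in the Newton basis. *)
Lemma scaled_eigenrows_LU sigma : (forall i, sigma i != 0) ->
  exists U, [/\ is_trig_mx U^T, forall i, U i i = sigma i * q i i * s i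
    & scaled_eigenrows sigma = newton_lower sigma *m U].
Proof.
move=> sigma_neq0.
have [D [/is_trig_mxP trigD D1 def_P]] :=
  graded_change (@jpoly_graded R n (diag_entry w) (offdiag_sqr v))
                (newton_graded mu).
exists (\matrix_(j, k) (sigma j * q j j * D j k * s k)); split=> [|i|].
- apply/is_trig_mxP => i j ltij; have := trigD i j ltij; rewrite !mxE => ->.
  by rewrite mulr0 mul0r.
- by rewrite mxE D1 mulr1.
apply/matrixP => i k; rewrite !mxE /P /flaschka_poly def_P horner_sum.
rewrite mulr_sumr; apply: eq_bigr => j _; rewrite !mxE hornerZ -/(q i j).
have := newton_neq0 j mu_inj; rewrite -/(q j j) => qj.
by field; rewrite qj sigma_neq0.
Qed.

Lemma scaled_eigenrows_gram sigma :
  scaled_eigenrows sigma *m (scaled_eigenrows sigma)^T =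
  diag_mx (\row_i (sigma i ^+ 2 * spectral_norm v w (mu i))).
Proof.
have /matrixP orth := jpoly_rows_orthogonal (offdiag_sqr0 v)
  (@offdiag_inv_norm _ _ v) mu_inj mu_root.
apply/matrixP => i j; have := orth i j.
rewrite !mxE mul_mx_diag => H.
have := congr1 ( *%R (sigma i * sigma j)) H.
rewrite mulr_sumr => H'.
transitivity (sigma i * sigma j *
    (christoffel n (diag_entry w) (offdiag_sqr v) (inv_norm v) (mu i) *+ (i == j))).
  rewrite -H'; apply: eq_bigr => k _; rewrite !mxE -inv_norm_sqrt_sqr -/(s k).
  by rewrite /P /flaschka_poly; ring.
by rewrite /spectral_norm; case: eqP => [->|_]; rewrite ?mulr0 // mulr1n expr2.
Qed.

Let Lam : 'M[R]_n := diag_mx (\row_k mu k).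
Let J := flaschka v w.

Let row_Lam i (A : 'M[R]_n) : row i (Lam *m A) = mu i *: row i A.
Proof. by apply/rowP => k; rewrite mul_diag_mx !mxE. Qed.

Lemma scaled_eigenrows_eigen sigma :
  scaled_eigenrows sigma *m J = Lam *m scaled_eigenrows sigma.
Proof.
apply/row_matrixP => i; rewrite row_mul row_Lam.
have -> : row i (scaled_eigenrows sigma) =
    sigma i *: \row_k (inv_norm_sqrt v k * (flaschka_poly v w k).[mu i]).
  by apply/rowP => k; rewrite !mxE mulrA.
by rewrite -scalemxAl root_eigenvector // !scalerA mulrC.
Qed.

(** Every orthogonal diagonalizer has this form: its rows are eigenvectors, and
    their normalization fixes the scalars up to sign. *)
Lemma orthogonal_eigenrows Q : Q^T *m Q = 1%:M -> J = Q^T *m Lam *m Q ->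
  exists2 sigma, (forall i, sigma i ^+ 2 * spectral_norm v w (mu i) = 1)
    & Q = scaled_eigenrows sigma.
Proof.
move=> orthQ defJ; have orthQ' := mulmx1C orthQ.
have eigQ i : row i Q *m J = mu i *: row i Q.
  have : Q *m J = Lam *m Q by rewrite defJ !mulmxA orthQ' mul1mx.
  by move=> /(congr1 (row i)); rewrite row_mul row_Lam.
have /choice[sigma sigmaE] i : exists c, forall k : 'I_n,
    row i Q 0 k = c * s k * P i k.
  by have [c def_row _] := eigen_coords (eigQ i); exists c.
have defQ : Q = scaled_eigenrows sigma.
  by apply/matrixP => i k; have := sigmaE i k; rewrite !mxE.
exists sigma => // i; have := scaled_eigenrows_gram sigma.
rewrite -defQ orthQ' => /matrixP/(_ i i).
by rewrite !mxE eqxx mulr1n.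
Qed.

Lemma normalized_eigenrows sigma :
  (forall i, sigma i ^+ 2 * spectral_norm v w (mu i) = 1) ->
  let Q := scaled_eigenrows sigma in
  Q^T *m Q = 1%:M /\ J = Q^T *m Lam *m Q.
Proof.
move=> sigma1 Q; have orthQ : Q^T *m Q = 1%:M.
  apply: mulmx1C; rewrite scaled_eigenrows_gram; apply/matrixP => i j.
  by rewrite !mxE sigma1.
split=> //; rewrite -mulmxA -scaled_eigenrows_eigen mulmxA orthQ.
by rewrite mul1mx.
Qed.

(** The sign makes the diagonal of the upper factor positive. *)
Definition LU_row_scale (i : 'I_n) : R :=
  Num.sg (q i i) / Num.sqrt (spectral_norm v w (mu i)).

Let g_gt0 i : 0 < spectral_norm v w (mu i).
Proof. exact: spectral_norm_gt0 (ord_pos i). Qed.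

Lemma LU_diagonalizerP lambda (pi : 'S_n) : mu = lambda \o pi ->
  let Q := LU_diagonalizer J lambda pi in
  exists sigma, [/\ forall i, sigma i ^+ 2 * spectral_norm v w (mu i) = 1,
    Q = scaled_eigenrows sigma & LU_positive Q].
Proof.
move=> def_mu Q; have defLam : diag_perm lambda pi = Lam.
  by rewrite /diag_perm /Lam def_mu.
have q_neq0 i : q i i != 0 by exact: newton_neq0.
have sg1 i : LU_row_scale i ^+ 2 * spectral_norm v w (mu i) = 1.
  rewrite /LU_row_scale exprMn exprVn sqr_sqrtr ?(ltW (g_gt0 i)) //.
  by rewrite sqr_sg q_neq0 mul1r mulVf // gt_eqF.
have sg_neq0 i : LU_row_scale i != 0.
  by apply: contra_eq_neq (sg1 i) => ->; rewrite expr0n mul0r eq_sym oner_neq0.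
have [orthQ LUQ defJ] : [set Q : 'M[R]_n | [/\ Q^T *m Q = 1%:M, LU_positive Q
                    & J = Q^T *m diag_perm lambda pi *m Q]] Q.
  apply: xgetPex; exists (scaled_eigenrows LU_row_scale) => /=.
  have [orth defJ] := normalized_eigenrows sg1; split=> //; last first.
    by rewrite defLam.
  have [U [trigU diagU defQ]] := scaled_eigenrows_LU sg_neq0.
  exists (newton_lower LU_row_scale), U; split=> //.
    exact: newton_lower_unit.
  split=> // i; rewrite diagU mulr_gt0 // /LU_row_scale mulrAC -normrEsg.
  by rewrite divr_gt0 ?normr_gt0 ?sqrtr_gt0.
rewrite defLam in defJ.
have [sigma sigma1 defQ] := orthogonal_eigenrows orthQ defJ.
by exists sigma.
Qed.

(** The bidiagonal matrix with diagonal [mu] and subdiagonal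
    [gam (j + 1) / gam j] satisfies [L *m B = Lam *m L], entry by entry, by
    [newton mu (j + 1) = newton mu j * (X - mu j)]; there is no next column
    after the last one, consistently with [newton mu n] vanishing at all
    nodes. *)
Theorem bidiagonal_coordE lambda (pi : 'S_n) (k : 'I_n.-1) : mu = lambda \o pi ->
  bidiagonal_coord J lambda pi k = Num.sqrt
    (asym_weight v w mu (ord_next k) / asym_weight v w mu (ord_this k)).
Proof.
move=> def_mu; have [sigma [sigma1 defQ LUQ]] := LU_diagonalizerP def_mu.
have defLam : diag_perm lambda pi = Lam by rewrite /diag_perm /Lam def_mu.
rewrite /bidiagonal_coord /bidiagonal_mx; set L := LU_lower _.
have sg_neq0 i : sigma i != 0.
  by apply: contra_eq_neq (sigma1 i) => ->; rewrite expr0n mul0r eq_sym oner_neq0.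
have q_neq0 i : q i i != 0 by exact: newton_neq0.
have [luL [U upU defLU]] : [set L | lower_unit L /\ exists2 U, upper_pos U
    & LU_diagonalizer J lambda pi = L *m U] L.
  apply: xgetPex; have [L' [U [luL' upU defLU]]] := LUQ.
  by exists L'; split=> //; exists U.
have [U0 [trigU0 diagU0 defLU0]] := scaled_eigenrows_LU sg_neq0.
have [trigU U_gt0] := upU.
have [defL defU] : L = newton_lower sigma /\ U = U0.
  apply: LU_unique => //; first exact: newton_lower_unit.
    by move=> i; rewrite gt_eqF.
  by rewrite -defLU -defLU0 -defQ.
pose gam i := sigma i * q i i.
have gam_gt0 i : 0 < gam i.
  by have := U_gt0 i; rewrite defU diagU0 pmulr_lgt0.
have gam_sqr i : gam i ^+ 2 = asym_weight v w mu i.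
  have := sigma1 i; have := g_gt0 i; rewrite /asym_weight /gam.
  rewrite -/(q i i); move: (spectral_norm _ _ _) => g g_gt0' sg1.
  apply: (mulIf (lt0r_neq0 g_gt0')).
  by rewrite divfK ?gt_eqF // exprMn mulrAC sg1 mul1r.
pose B : 'M[R]_n := \matrix_(i, j)
  (if i == j then mu i else if i == j.+1 :> nat then gam i / gam j else 0).
have LB : L *m B = Lam *m L.
  rewrite defL; apply/matrixP => i j.
  have qS : (newton mu j.+1).[mu i] = q i j * (mu i - mu j).
    by rewrite newtonS hornerM hornerXsubC.
  have gam_neq0 k' : gam k' != 0 by rewrite gt_eqF.
  rewrite mul_diag_mx !mxE (bigD1 j) //= !mxE eqxx.
  have [ltjn|lenj] := ltnP j.+1 n; last first.
    rewrite big1 ?addr0 => [|k' neqk'j]; last first.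
      rewrite !mxE (negPf neqk'j) ifF ?mulr0 // ltn_eqF //.
      exact: leq_trans (ltn_ord k') lenj.
    have : q i j * (mu i - mu j) = 0.
      by rewrite -qS newton_node // (leq_trans (ltn_ord i) lenj).
    move=> /eqP; rewrite mulrBr subr_eq0 => /eqP qmu.
    rewrite (_ : _ * mu j = sigma i / gam j * (q i j * mu j)); last by ring.
    by rewrite -qmu; ring.
  pose j1 := Ordinal ltjn.
  have neqj1 : j1 != j by rewrite -val_eqE /= gtn_eqF.
  rewrite (bigD1 j1) //= big1 ?addr0 => [|k' /andP[neqk'j neqk'j1]]; last first.
    by rewrite !mxE (negPf neqk'j) ifN ?mulr0.
  rewrite !mxE (negPf neqj1) eqxx -/(gam j) -/(gam j1) {2}/q /= qS.
  by field; rewrite !gam_neq0.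
have unitL : L \in unitmx.
  rewrite unitmxE det_trig; last by case: luL.
  by rewrite big1 ?unitr1 // => i _; case: luL.
rewrite defLam -mulmxA -LB mulKmx // mxE.
rewrite ifN; last by rewrite -val_eqE /= gtn_eqF.
rewrite eqxx -!gam_sqr -expr_div_n sqrtr_sqr ger0_norm //.
by rewrite ltW // divr_gt0.
Qed.

End Bidiagonal.

(** * Wave maps, and the spectrum read off from the past velocities *)

Section PastVelocity.
Variable R : realType.

(** The position on [[t, t + 1]] has mean velocity close to [c], attained at
    some [xi], and the velocity hardly changes between [t] and [xi] since the
    acceleration is small there. *)
Lemma velocity_cvg_ninfty (f f1 f2 : R -> R) (c d : R) :
  (forall t : R, is_derive t 1 f (f1 t)) ->
  (forall t : R, is_derive t 1 f1 (f2 t)) ->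
  (f t - c * t - d) @[t --> -oo] --> (0 : R) -> f2 t @[t --> -oo] --> (0 : R) ->
  f1 t @[t --> -oo] --> c.
Proof.
move=> df df1 /cvgrPdist_lt lim_f /cvgrPdist_lt lim_f2.
have contf t : {for t, continuous f}.
  by apply: differentiable_continuous; apply/derivable1_diffP; case: (df t).
have contf1 t : {for t, continuous f1}.
  by apply: differentiable_continuous; apply/derivable1_diffP; case: (df1 t).
apply/cvgrPdist_lt => e e_gt0; have e3_gt0 : 0 < e / 3 by rewrite divr_gt0.
have [M1 [_ ltf]] := lim_f _ e3_gt0; have [M2 [_ ltf2]] := lim_f2 _ e3_gt0.
(* The margin 1 keeps [t, t + 1] in the range of both bounds. *)
exists (Num.min M1 M2 - 1); split; first exact: num_real.
move=> t /=; rewrite ltrBrDr lt_min => /andP[ltM1 ltM2].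
have ltt1 : t < t + 1 by rewrite ltrDl.
have [xi] := MVT ltt1 (fun s _ => df s) (continuous_subspaceT contf).
rewrite in_itv /= => /andP[lttxi ltxit] slope.
have [eta] := MVT lttxi (fun s _ => df1 s) (continuous_subspaceT contf1).
rewrite in_itv /= => /andP[ltteta ltetaxi] slope1.
have ltM1' : t < M1 by rewrite (lt_trans _ ltM1) // ltrDl.
have lteta : eta < M2.
  by rewrite (lt_trans ltetaxi) // (lt_trans ltxit).
have := ltf t ltM1'; have := ltf (t + 1) ltM1; have := ltf2 eta lteta.
rewrite /= !sub0r !normrN !ltr_norml => /andP[h1 h2] /andP[h3 h4] /andP[h5 h6].
have h7 : `|f2 eta * (xi - t)| < e / 3.
  rewrite normrM (le_lt_trans _ (_ : `|f2 eta| < _)) //; last first.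
    by rewrite ltr_norml h1 h2.
  rewrite ler_piMr // ger0_norm; lra.
move: h7; rewrite ltr_norml => /andP[h7 h8].
apply/andP; split; lra.
Qed.


End PastVelocity.

Section PastSpectrum.
Variables (R : realType) (n : nat) (x y : R -> 'rV[R]_n) (cd : 'rV[R]_n * 'rV[R]_n).
Hypothesis sol : toda_solution x y.
Hypothesis asym : toda_asymptotics (ninfty_nbhs R) x cd.
Hypothesis c_decr : forall i j : 'I_n, (i < j)%N -> cd.1 0 j < cd.1 0 i.

Lemma offdiag_cvg_ninfty k : offdiag_sqr (x t) k @[t --> -oo] --> (0 : R).
Proof.
rewrite /offdiag_sqr.
case: (boolP (0 < k < n)%N) => [/andP[k_gt0 ltkn]|_]; last exact: cvg_cst.
have ltk : (k.-1 < n)%N by rewrite (leq_ltn_trans (leq_pred k)).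
pose i := Ordinal ltk; pose j := Ordinal ltkn.
have ltij : (i < j)%N by rewrite /= prednK.
pose r t := (x t 0 i - cd.1 0 i * t - cd.2 0 i)
            - (x t 0 j - cd.1 0 j * t - cd.2 0 j).
have r0 : r t @[t --> -oo] --> (0 : R).
  by rewrite -(subrr (0 : R)); apply: cvgB; exact: asym.
have er : expR (r t) @[t --> -oo] --> (1 : R).
  by rewrite -expR0; apply: continuous_cvg => //; exact: continuous_expR.
have ct : expR ((cd.1 0 i - cd.1 0 j) * t) @[t --> -oo] --> (0 : R).
  by apply: cvg_expR_linear_ninfty; rewrite subr_gt0 c_decr.
rewrite (_ : (fun t => _) = fun t => expR (cd.2 0 i - cd.2 0 j) / 4
    * (expR (r t) * expR ((cd.1 0 i - cd.1 0 j) * t))); last first.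
  apply/funext => t; rewrite mulrAC -!expRD (ext_ord _ j) (ext_ord _ i).
  by congr (expR _ / 4); rewrite /r; ring.
by apply: cvgMr0; rewrite -(mulr0 1); exact: cvgM.
Qed.

Lemma velocity_asymptotic (k : 'I_n) : y t 0 k @[t --> -oo] --> cd.1 0 k.
Proof.
have dx t := (sol t k).1; have dy t := (sol t k).2.
apply: (velocity_cvg_ninfty dx dy (asym k)).
rewrite (_ : (fun t => _) = fun t => 4 * (offdiag_sqr (x t) k
    - offdiag_sqr (x t) k.+1)); last by apply/funext => t; rewrite toda_forceE.
apply: cvgMr0; rewrite -(subrr (0 : R)).
by apply: cvgB; exact: offdiag_cvg_ninfty.
Qed.

Let mu (i : 'I_n) : R := - (cd.1 0 i / 2).

Lemma flaschka_poly_cvg z k : (k <= n)%N ->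
  (flaschka_poly (x t) (y t) k).[z] @[t --> -oo] --> (newton mu k).[z].
Proof.
elim/ltn_ind: k => -[_ _|k IHk ltkn].
  by rewrite /newton big_pred0 //; exact: cvg_cst.
have lekn := ltnW ltkn; have lek'n := leq_trans (leq_pred k) lekn.
have Pk := IHk k (ltnSn k) lekn; have Pk' := IHk k.-1 (leq_pred k) lek'n.
rewrite (newtonS mu (Ordinal ltkn)) hornerM hornerXsubC /=.
rewrite (_ : (fun t => _) = fun t =>
    (z + y t 0 (Ordinal ltkn) / 2) * (flaschka_poly (x t) (y t) k).[z]
    - offdiag_sqr (x t) k * (flaschka_poly (x t) (y t) k.-1).[z]); last first.
  apply/funext => t; rewrite /flaschka_poly horner_jpolyS /diag_entry.
  by rewrite (ext_ord _ (Ordinal ltkn)) opprK.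
rewrite [X in _ --> X](_ : _ = (z + cd.1 0 (Ordinal ltkn) / 2)
    * (newton mu k).[z] - 0 * (newton mu k.-1).[z]); last first.
  by rewrite mul0r subr0 mulrC opprK.
apply: cvgB; apply: cvgM => //; last exact: offdiag_cvg_ninfty.
apply: cvgD; first exact: cvg_cst.
by apply: cvgM; [exact: velocity_asymptotic | exact: cvg_cst].
Qed.

(** In the past the Flaschka matrix becomes diagonal, with entries
    [- c_k / 2]; its characteristic polynomial being constant in time, these
    are the eigenvalues at time 0.  This provides the whole spectrum of an
    initial condition known only through its wave data. *)
Lemma past_velocity_root k : (flaschka_poly (x 0) (y 0) n).[mu k] = 0.
Proof.
have := @flaschka_poly_cvg (mu k) n (leqnn n).
rewrite newton_node // (_ : (fun t => _) =
    fun=> (flaschka_poly (x 0) (y 0) n).[mu k]).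
  by move=> /(cvg_lim (@Rhausdorff R)); rewrite lim_cst.
by apply/funext => t; exact: (toda_poly_const sol).
Qed.

End PastSpectrum.

Section WaveMaps.
Variables (R : realType) (n : nat).
Implicit Types (v w : 'rV[R]_n) (x y : R -> 'rV[R]_n) (F : set_system R).
Implicit Types (mu lambda : 'I_n -> R) (cd : 'rV[R]_n * 'rV[R]_n).

Definition asym_data v w mu : 'rV[R]_n * 'rV[R]_n :=
  (\row_k (- 2 * mu k), \row_k asym_phase v w mu k).

Definition affine_separating F :=
  forall c d : R, (c * t + d) @[t --> F] --> (0 : R) -> c = 0 /\ d = 0.

Lemma toda_asymptotics_unique F {FF : Filter F} x cd cd' :
  affine_separating F -> toda_asymptotics F x cd -> toda_asymptotics F x cd' ->
  cd = cd'.
Proof.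
move=> sepF as1 as2.
have eqk k : cd.1 0 k = cd'.1 0 k /\ cd.2 0 k = cd'.2 0 k.
  have [] := sepF (cd'.1 0 k - cd.1 0 k) (cd'.2 0 k - cd.2 0 k).
    rewrite (_ : (fun t => _) = fun t => (x t 0 k - cd.1 0 k * t - cd.2 0 k)
        - (x t 0 k - cd'.1 0 k * t - cd'.2 0 k)); last first.
      by apply/funext => t; ring.
    by rewrite -(subrr (0 : R)); apply: cvgB; [exact: as1 | exact: as2].
  by move=> /eqP; rewrite subr_eq0 => /eqP-> /eqP; rewrite subr_eq0 => /eqP->.
case: cd cd' eqk {as1 as2} => [c d] [c' d'] /= eqk.
by congr pair; apply/rowP => k; have [] := eqk k.
Qed.

(** Two trajectories with the same initial data share their asymptotes when
    these depend on the initial data alone, whichever trajectory the wave map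
    selects. *)
Lemma wave_mapE F {FF : Filter F} x y cd :
  affine_separating F -> toda_solution x y ->
  (forall x' y', toda_solution x' y' -> x' 0 = x 0 -> y' 0 = y 0 ->
     toda_asymptotics F x' cd) ->
  wave_map F (x 0, y 0) = cd.
Proof.
move=> sepF sol asym; apply: xget_unique => [|cd' [x' [y' [sol' [ex ey] asym']]]].
  by exists x, y; split=> //; exact: asym.
by apply: (toda_asymptotics_unique sepF asym'); exact: asym sol' ex ey.
Qed.

Definition ordered_roots v w lambda :=
  (forall i j : 'I_n, (i < j)%N -> lambda i < lambda j) /\
  (forall i, (flaschka_poly v w n).[lambda i] = 0).

Lemma ordered_inj lambda :
  (forall i j : 'I_n, (i < j)%N -> lambda i < lambda j) -> injective lambda.
Proof.
move=> incr i j eqij; apply/val_inj/eqP; rewrite eqn_leq.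
by apply/andP; split; rewrite leqNgt; apply/negP => /incr; rewrite eqij ltxx.
Qed.

Lemma toda_asymptotics_past x y lambda : toda_solution x y ->
  ordered_roots (x 0) (y 0) lambda ->
  toda_asymptotics (ninfty_nbhs R) x (asym_data (x 0) (y 0) lambda).
Proof.
move=> sol [incr root] k; rewrite !mxE.
apply: (toda_asymptoticsP sol (ordered_inj incr) root) => i j ltij.
by apply: cvg_expR_linear_ninfty; rewrite mulr_gt0 // subr_gt0 incr.
Qed.

Lemma toda_asymptotics_future x y lambda : toda_solution x y ->
  ordered_roots (x 0) (y 0) lambda ->
  toda_asymptotics (pinfty_nbhs R) x
    (asym_data (x 0) (y 0) (lambda \o @rev_ord n)).
Proof.
move=> sol [incr root] k; rewrite !mxE.
have inj : injective (lambda \o @rev_ord n).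
  exact: inj_comp (ordered_inj incr) (@rev_ord_inj n).
apply: (toda_asymptoticsP sol inj) => [i|i j ltij]; first exact: root.
apply: cvg_expR_linear_pinfty; rewrite pmulr_rlt0 // subr_lt0 incr //=.
by rewrite ltn_sub2lE.
Qed.

Lemma wave_minusE x y lambda : toda_solution x y ->
  ordered_roots (x 0) (y 0) lambda ->
  wave_minus (x 0, y 0) = asym_data (x 0) (y 0) lambda.
Proof.
move=> sol roots; apply: wave_mapE sol _; first exact: affine_cvg0_ninfty.
move=> x' y' sol' ex ey; rewrite -ex -ey.
by apply: toda_asymptotics_past sol' _; rewrite ex ey.
Qed.

Lemma wave_plusE x y lambda : toda_solution x y ->
  ordered_roots (x 0) (y 0) lambda ->
  wave_plus (x 0, y 0) = asym_data (x 0) (y 0) (lambda \o @rev_ord n).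
Proof.
move=> sol roots; apply: wave_mapE sol _; first exact: affine_cvg0_pinfty.
move=> x' y' sol' ex ey; rewrite -ex -ey.
by apply: toda_asymptotics_future sol' _; rewrite ex ey.
Qed.

End WaveMaps.

(** * Comparison of the phases *)

Section PhaseFormulas.
Variables (R : realType) (n : nat).
Implicit Types (v w : 'rV[R]_n) (mu lambda : 'I_n -> R).

Lemma ln_asym_weight v w mu (k : 'I_n) : injective mu ->
  ln (asym_weight v w mu k) =
  2 * (\sum_(j < n | (j < k)%N) ln `|mu j - mu k|)
  - ln (spectral_norm v w (mu k)).
Proof.
move=> mu_inj.
have q_neq0 := newton_neq0 k mu_inj.
have g_gt0 := @spectral_norm_gt0 R n v w (mu k) (ord_pos k).
rewrite /asym_weight ln_div ?posrE ?exprn_even_gt0 //; congr (_ - _).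
rewrite -real_normK ?num_real // lnXn ?normr_gt0 // -[LHS]mulr_natl; congr (2 * _).
rewrite horner_newton normr_prod ln_prod => [|j ltjk].
  by apply: eq_bigr => j _; rewrite distrC.
rewrite normr_gt0 subr_eq0 (inj_eq mu_inj); apply: contraTneq ltjk => ->.
by rewrite ltnn.
Qed.

Lemma sum_lt_rev (k : 'I_n) (f : 'I_n -> R) :
  \sum_(j < n | (j < rev_ord k)%N) f (rev_ord j) = \sum_(j < n | (k < j)%N) f j.
Proof.
rewrite [RHS](reindex_inj rev_ord_inj) /=; apply: eq_bigl => j.
by rewrite ltn_subCr ltn_subRL; lia.
Qed.

Lemma sum_lt_const (k : 'I_n) (c : R) : \sum_(j < n | (j < k)%N) c = k%:R * c.
Proof.
rewrite -(@big_ord_widen _ _ _ k n (fun=> c)) ?(ltnW (ltn_ord k)) //.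
by rewrite sumr_const card_ord mulr_natl.
Qed.

(** The spectral norms cancel between the two orders.  What is left of the
    [ln 2] terms, [2 (k - (n - 1 - k)) ln 2], is absorbed by passing from
    differences of eigenvalues to differences of velocities. *)
Lemma asym_phase_rev v w lambda (k : 'I_n) : injective lambda ->
  asym_phase v w (lambda \o @rev_ord n) (rev_ord k) = asym_phase v w lambda k
    + 2 * (\sum_(j < n | (j < k)%N) ln `|- 2 * lambda j - - 2 * lambda k|)
    - 2 * (\sum_(j < n | (k < j)%N) ln `|- 2 * lambda j - - 2 * lambda k|).
Proof.
move=> inj; have inj' : injective (lambda \o @rev_ord n).
  exact: inj_comp inj (@rev_ord_inj n).
have ln_double j : j != k -> ln `|- 2 * lambda j - - 2 * lambda k|
    = ln `|lambda j - lambda k| + ln 2.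
  move=> neqjk; rewrite -mulrBr normrM normrN normr_nat mulrC lnM ?posrE //.
  by rewrite normr_gt0 subr_eq0 (inj_eq inj).
have -> : \sum_(j < n | (j < k)%N) ln `|- 2 * lambda j - - 2 * lambda k|
    = \sum_(j < n | (j < k)%N) ln `|lambda j - lambda k| + k%:R * ln 2.
  rewrite -sum_lt_const -big_split; apply: eq_bigr => j ltjk.
  by rewrite ln_double // -val_eqE /= ltn_eqF.
have -> : \sum_(j < n | (k < j)%N) ln `|- 2 * lambda j - - 2 * lambda k|
    = \sum_(j < n | (k < j)%N) ln `|lambda j - lambda k|
      + (rev_ord k)%:R * ln 2.
  rewrite -sum_lt_const (sum_lt_rev k (fun=> ln 2)) -big_split.
  by apply: eq_bigr => j ltkj; rewrite ln_double // -val_eqE /= gtn_eqF.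
rewrite /asym_phase !ln_asym_weight //= rev_ordK.
rewrite (sum_lt_rev k (fun j => ln `|lambda j - lambda k|)).
by ring.
Qed.

End PhaseFormulas.

Section Abel.
Variable R : realType.

(** Weights counting down to zero isolate the first term: this expresses
    [d 0] by the gaps and the sum of all the terms. *)
Lemma sum_by_parts (m : nat) (d : nat -> R) :
  \sum_(j < m) (m%:R - j%:R) * (d j - d j.+1) =
  m.+1%:R * d 0%N - \sum_(j < m.+1) d j.
Proof.
elim: m => [|m IHm]; first by rewrite big_ord0 big_ord1; ring.
rewrite big_ord_recr [in RHS]big_ord_recr /=.
have -> : \sum_(j < m) (m.+1%:R - j%:R) * (d j - d j.+1) =
    \sum_(j < m) (m%:R - j%:R) * (d j - d j.+1) + (d 0%N - d m).
  have -> : d 0%N - d m = \sum_(j < m) (d j - d j.+1).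
    elim: m {IHm} => [|m IHm]; first by rewrite big_ord0 subrr.
    by rewrite big_ord_recr /= -IHm; ring.
  by rewrite -big_split; apply: eq_bigr => j _ /=; rewrite -natr1; ring.
by rewrite IHm -!natr1; ring.
Qed.

Lemma sum_countdown (m : nat) :
  \sum_(j < m) (m%:R - j%:R) = m%:R * m.+1%:R / 2 :> R.
Proof.
elim: m => [|m IHm]; first by rewrite big_ord0; ring.
rewrite big_ord_recr /= (eq_bigr (fun j : 'I_m => (m%:R - j%:R) + 1)).
  by rewrite big_split /= IHm sumr_const card_ord -!natr1; field.
by move=> j _; rewrite -natr1; ring.
Qed.

(** [sum_by_parts] gives [k = 0]; raising [k] by one moves a single gap from
    the second sum to the first and changes its weight by [- 2]. *)
Lemma recover_from_gaps (m : nat) (d g : nat -> R) (l : R) :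
  \sum_(j < m.+1) d j = 0 ->
  (forall j, (j < m)%N -> d j - d j.+1 = 2 * g j + 2 * l) ->
  forall k, (k < m.+1)%N ->
  d k = \sum_(j < m | (j < k)%N) (- 2 * j.+1%:R / m.+1%:R) * g j
      + \sum_(j < m | (k <= j)%N) (2 * (m.+1%:R - j.+1%:R) / m.+1%:R) * g j
      + (m.+1%:R - 2 * k.+1%:R + 1) * l.
Proof.
move=> sum0 gap; have m1 : m.+1%:R != 0 :> R by rewrite pnatr_eq0.
elim=> [_|k IHk ltkm].
  rewrite big_pred0 // add0r; apply: (mulfI m1).
  have := sum_by_parts m d; rewrite sum0 subr0 => <-.
  rewrite (eq_bigr (fun j : 'I_m => 2 * (m%:R - j%:R) * g j
      + (m%:R - j%:R) * (2 * l))) => [|j _]; last by rewrite gap //; ring.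
  rewrite big_split mulrDr /=; congr (_ + _).
    rewrite mulr_sumr; apply: eq_bigr => j _; rewrite -!natr1.
    by field; rewrite natr1.
  by rewrite -mulr_suml sum_countdown -!natr1; field.
pose i := Ordinal (ltkm : (k < m)%N).
have -> : d k.+1 = d k - (2 * g k + 2 * l) by rewrite -gap //; ring.
rewrite IHk 1?ltnW //.
rewrite [X in _ = X + _ + _](bigD1 i) //=.
rewrite [X in _ + X + _ - _ = _](bigD1 i) //=.
rewrite (eq_bigl (fun j : 'I_m => (j < k.+1)%N && (j != i))); last first.
  by move=> j; rewrite ltnS ltn_neqAle andbC.
rewrite [X in _ + (_ + X) + _ - _](eq_bigl (fun j : 'I_m => (k < j)%N)); last first.
  by move=> j; rewrite ltn_neqAle andbC eq_sym.
rewrite -!natr1; field.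
by rewrite natr1.
Qed.

End Abel.

(** * The phases in bidiagonal coordinates and the scattering map *)

Section PhaseBidiagonal.
Variables (R : realType) (n : nat) (x y : R -> 'rV[R]_n).
Hypothesis sol : toda_solution x y.
Hypothesis sum_x0 : \sum_k x 0 0 k = 0.
Variables (lambda : 'I_n -> R) (pi : 'S_n).
Let mu := lambda \o pi.
Hypothesis mu_inj : injective mu.
Hypothesis mu_root : forall i, (flaschka_poly (x 0) (y 0) n).[mu i] = 0.
Let beta := bidiagonal_coord (flaschka (x 0) (y 0)) lambda pi.
Let d := asym_phase (x 0) (y 0) mu.

(** The phase is minus the logarithm of [asym_weight], and
    [bidiagonal_coord] is the square root of a ratio of consecutive
    weights. *)
Lemma asym_phase_gap (j : 'I_n.-1) :
  d (ord_this j) - d (ord_next j) = 2 * ln (beta j) + 2 * ln 2.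
Proof.
rewrite /beta (bidiagonal_coordE mu_inj mu_root _ (erefl mu)) /d /asym_phase.
have w_gt0 k := @asym_weight_gt0 R n (x 0) (y 0) mu k mu_inj.
have := w_gt0 (ord_next j); have := w_gt0 (ord_this j).
move: (asym_weight _ _ _ _) => a; move: (asym_weight _ _ _ _) => b a_gt0 b_gt0.
have ba_gt0 : 0 < b / a by rewrite divr_gt0.
have -> : 2 * ln (Num.sqrt (b / a)) = ln (b / a).
  by rewrite -[in RHS](sqr_sqrtr (ltW ba_gt0)) lnXn ?sqrtr_gt0 // mulr_natl.
by rewrite ln_div ?posrE //= -natr1; ring.
Qed.

Lemma asym_phase_bidiagonal (k : 'I_n) :
  d k = \sum_(j < n.-1 | (j < k)%N) (- 2 * j.+1%:R / n%:R) * ln (beta j)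
      + \sum_(j < n.-1 | (k <= j)%N)
          (2 * (n%:R - j.+1%:R) / n%:R) * ln (beta j)
      + (n%:R - 2 * k.+1%:R + 1) * ln 2.
Proof.
have n_gt0 := ord_pos k.
pose d' (j : nat) := if insub j is Some i then d i else 0.
pose g (j : nat) := if insub j is Some i then ln (beta i) else 0.
have d'E (i : 'I_n) : d' i = d i by rewrite /d' valK.
have gE (i : 'I_n.-1) : g i = ln (beta i) by rewrite /g valK.
have def_n : n.-1.+1 = n by rewrite prednK.
have := @recover_from_gaps R n.-1 d' g (ln 2).
rewrite def_n -d'E => ->.
- by congr (_ + _ + _); apply: eq_bigr => j _; rewrite gE.
- under eq_bigr do rewrite d'E.
  by rewrite (sum_asym_phase sol mu_inj mu_root).
- move=> j ltj; rewrite -[j]/(val (Ordinal ltj)) gE -asym_phase_gap.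
  by rewrite -!d'E.
- exact: ltn_ord.
Qed.

End PhaseBidiagonal.

Section Scattering.
Variables (R : realType) (n : nat).

(** A point with the given past wave data lies on a trajectory with these
    asymptotes: the default value [(0, 0)] is excluded because the velocities
    [- 2 lambda_i] differ.  Its spectrum is then [lambda], and its future data
    follow from its past phases by [asym_phase_rev]. *)
Lemma scattering_mapE (x y : R -> 'rV[R]_n) (lambda : 'I_n -> R) :
  (2 <= n)%N -> toda_solution x y -> ordered_roots (x 0) (y 0) lambda ->
  scattering_map (asym_data (x 0) (y 0) lambda) =
  asym_data (x 0) (y 0) (lambda \o @rev_ord n).
Proof.
move=> n_ge2 sol roots; have [incr _] := roots.
have inj := ordered_inj incr.
apply: xget_unique => [|cd' [z wave_z <-]].
  by exists (x 0, y 0); [exact: wave_minusE | exact: wave_plusE].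
have [x' [y' [sol' def_z asym']]] : [set cd | exists x' y' : R -> 'rV[R]_n,
    [/\ toda_solution x' y', (x' 0, y' 0) = z
      & toda_asymptotics (ninfty_nbhs R) x' cd]]
    (asym_data (x 0) (y 0) lambda).
  rewrite -wave_z /wave_minus /wave_map; case: xgetP => [//|none].
  move: wave_z; rewrite /wave_minus /wave_map xgetPN // => -[/rowP c0 _].
  (* Were there no such trajectory, all velocities would be 0. *)
  pose i0 := Ordinal (ltnW n_ge2); pose i1 := Ordinal n_ge2.
  have := c0 i0; have := c0 i1; have := incr i0 i1 isT.
  rewrite !mxE; lra.
have roots' : ordered_roots (x' 0) (y' 0) lambda.
  split=> // i; have := past_velocity_root sol' asym' _ i.
  rewrite /= mxE (_ : - (_ / 2) = lambda i); last by field.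
  by apply=> j k /incr ltjk; rewrite !mxE; lra.
rewrite -def_z in wave_z *.
have := wave_minusE sol' roots'; rewrite wave_z => -[/rowP eq_phase].
rewrite (wave_plusE sol' roots'); congr pair; apply/rowP => k.
rewrite !mxE -(rev_ordK k) !asym_phase_rev //.
by have := eq_phase (rev_ord k); rewrite !mxE => ->.
Qed.

End Scattering.

Theorem proposition5p2 (R : realType) (n : nat) (hn : (2 <= n)%N)
    (x y : R -> 'rV[R]_n) (hxy : toda_solution x y)
    (hx0 : \sum_(k < n) x 0 0 k = 0) (hy0 : \sum_(k < n) y 0 0 k = 0)
    (lambda : 'I_n -> R)
    (hlambda : ordered_spectrum (flaschka (x 0) (y 0)) lambda) :
  let J := flaschka (x 0) (y 0) in
  let betam := bidiagonal_coord J lambda (perm_minus n) in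
  let betap := bidiagonal_coord J lambda (perm_plus n) in
  let Wm := wave_minus (x 0, y 0) in
  let Wp := wave_plus (x 0, y 0) in
  let cm := Wm.1 in let dm := Wm.2 in
  let cp := Wp.1 in let dp := Wp.2 in
  [/\ toda_asymptotics (ninfty_nbhs R) x (cm, dm) /\
      toda_asymptotics (pinfty_nbhs R) x (cp, dp),
      forall k : 'I_n,
        cm 0 k = - 2 * lambda (perm_minus n k) /\
        dm 0 k = \sum_(j < n.-1 | (j < k)%N) (- 2 * j.+1%:R / n%:R) * ln (betam j)
               + \sum_(j < n.-1 | (k <= j)%N)
                   (2 * (n%:R - j.+1%:R) / n%:R) * ln (betam j)
               + (n%:R - 2 * k.+1%:R + 1) * ln 2,
      forall k : 'I_n,
        cp 0 k = - 2 * lambda (perm_plus n k) /\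
        dp 0 k = \sum_(j < n.-1 | (j < k)%N) (- 2 * j.+1%:R / n%:R) * ln (betap j)
               + \sum_(j < n.-1 | (k <= j)%N)
                   (2 * (n%:R - j.+1%:R) / n%:R) * ln (betap j)
               + (n%:R - 2 * k.+1%:R + 1) * ln 2,
      scattering_map (cm, dm) = (cp, dp)
    & forall k : 'I_n,
        cp 0 (rev_ord k) = cm 0 k /\
        dp 0 (rev_ord k) = dm 0 k
          + 2 * (\sum_(j < n | (j < k)%N) ln `|cm 0 j - cm 0 k|)
          - 2 * (\sum_(j < n | (k < j)%N) ln `|cm 0 j - cm 0 k|)].
Proof.
move=> J betam betap Wm Wp cm dm cp dp.
have [incr eig] := hlambda.
have roots : ordered_roots (x 0) (y 0) lambda.
  by split=> // i; exact: eigenvalue_root.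
have inj := ordered_inj incr.
have defm : lambda \o perm_minus n = lambda.
  by apply/funext => k; rewrite /= /perm_minus perm1.
have defp : lambda \o perm_plus n = lambda \o @rev_ord n.
  by apply/funext => k; rewrite /= /perm_plus permE.
have injp : injective (lambda \o perm_plus n).
  exact: inj_comp inj perm_inj.
have WmE : Wm = asym_data (x 0) (y 0) lambda by exact: wave_minusE.
have WpE : Wp = asym_data (x 0) (y 0) (lambda \o @rev_ord n).
  exact: wave_plusE.
rewrite /cm /dm /cp /dp -!surjective_pairing WmE WpE.
split.
- by split; [exact: toda_asymptotics_past | exact: toda_asymptotics_future].
- move=> k; rewrite !mxE perm1; split=> //; rewrite -{1}defm.
  apply: asym_phase_bidiagonal => //; first by rewrite defm.
  by move=> i; apply: roots.2.
- move=> k; rewrite !mxE permE; split=> //; rewrite -{1}defp.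
  by apply: asym_phase_bidiagonal => // i; apply: roots.2.
- exact: scattering_mapE.
- move=> k; rewrite !mxE /= rev_ordK; split=> //.
  rewrite asym_phase_rev //; congr (_ + 2 * _ - 2 * _);
    by apply: eq_bigr => j _; rewrite !mxE.
Qed.
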